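(* There is an absolute constant $b_0>0$ such that the following statements hold for all $\lambda>0$, all finite connected transitive graphs $\mathbb G$ (with $V$ vertices of degree $\Omega$), and all $p\in[0,1]$ of the form $p=p_c-\Omega^{-1}\epsilon$ with $\epsilon\ge0$, where $p_c=p_c(\mathbb G,\lambda)$. Put $\epsilon_0=1/\chi(p_c)=\lambda^{-1}V^{-1/3}$. (i) If the triangle condition $\nabla_{p_c}(x,y)\le\delta_{x,y}+a_0$ (for all $x,y\in\mathbb V$) holds for some $a_0<1$, then $$\frac{1}{\epsilon_0+\epsilon}\le\chi(p)\le\frac{1}{\epsilon_0+[1-a_0]\epsilon}.$$ (ii) If the triangle condition $\nabla_{p_c}(x,y)\le\delta_{x,y}+a_0$ (for all $x,y\in\mathbb V$) holds for some $a_0\le b_0$ and if $\lambda V^{1/3}\ge b_0^{-1}$, then $$10^{-4}\chi^2(p)\le\mathbb E_p\big(|\mathcal C_{\max}|\big)\le 2\chi^2(p)\log\big(V/\chi^3(p)\big),$$ $$\mathbb P_p\Big(|\mathcal C_{\max}|\le 2\chi^2(p)\log\big(V/\chi^3(p)\big)\Big)\ge 1-\frac{\sqrt e}{[2\log(V/\chi^3(p))]^{3/2}},$$ and, for every $\omega\ge1$, $$\mathbb P_p\Big(|\mathcal C_{\max}|\ge\frac{\chi^2(p)}{3600\,\omega}\Big)\ge\Big(1+\frac{36\chi^3(p)}{\omega V}\Big)^{-1}.$$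
   Context: $\mathbb G=(\mathbb V,\mathbb B)$ is a finite connected graph with vertex set $\mathbb V$ and bond (edge) set $\mathbb B$. It is transitive: for all $x,y\in\mathbb V$ there is a graph automorphism mapping $x$ to $y$. $V=|\mathbb V|$, and $\Omega$ is the common degree of the vertices. In percolation with parameter $p\in[0,1]$ each bond is independently occupied with probability $p$ and vacant otherwise; $\mathbb P_p,\mathbb E_p$ denote probability and expectation. $x\leftrightarrow y$ means there is a path of occupied bonds from $x$ to $y$ (and $x\leftrightarrow x$ always); $\tau_p(x,y)=\mathbb P_p(x\leftrightarrow y)$; $C(x)$ is the set of vertices connected to $x$; $0\in\mathbb V$ is a fixed vertex; $\chi(p)=\mathbb E_p|C(0)|$, a strictly increasing function of $p$ with $\chi(0)=1$, $\chi(1)=V$; $|\mathcal C_{\max}|=\max\{|C(x)|:x\in\mathbb V\}$. The triangle diagram is $\nabla_p(x,y)=\sum_{u,v\in\mathbb V}\tau_p(x,u)\tau_p(u,v)\tau_p(v,y)$. For $\lambda>0$, the critical threshold $p_c=p_c(\mathbb G,\lambda)$ is the unique solution of $\chi(p_c)=\lambda V^{1/3}$; it is always assumed that $1<\lambda V^{1/3}<V$, so that $p_c$ is well defined and $0<p_c<1$. *)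

(* Defs.v *)
From HB Require Import structures.
From mathcomp Require Import all_boot all_order all_algebra all_fingroup.
From mathcomp Require Import reals sequences exp.

Set Implicit Arguments.
Unset Strict Implicit.
Unset Printing Implicit Defensive.

Import Order.TTheory GRing.Theory Num.Theory.

Local Open Scope ring_scope.

(* A finite graph is a symmetric irreflexive adjacency relation [e] on a
   finite type [T] of vertices: there are no loops and no multiple bonds. *)

Definition simple_graph (T : finType) (e : rel T) : Prop :=
  symmetric e /\ irreflexive e.

Definition connected_graph (T : finType) (e : rel T) : Prop :=
  forall x y : T, connect e x y.

Definition automorphism (T : finType) (e : rel T) (s : {perm T}) : Prop :=
  forall u v : T, e (s u) (s v) = e u v.

Definition transitive_graph (T : finType) (e : rel T) : Prop :=
  forall x y : T, exists s : {perm T}, automorphism e s /\ s x = y.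

Definition degree (T : finType) (e : rel T) (x : T) : nat := #|[set y | e x y]|.

Definition bonds (T : finType) (e : rel T) : {set {set T}} :=
  [set [set u.1; u.2] | u in [set u : T * T | e u.1 u.2]].

(* A percolation configuration is identified with its set [w] of occupied
   bonds, so the sample space is [powerset (bonds e)]. *)

Definition occupied (T : finType) (w : {set {set T}}) : rel T :=
  fun x y => [set x; y] \in w.

Definition cluster (T : finType) (w : {set {set T}}) (x : T) : {set T} :=
  [set y | connect (occupied w) x y].

Definition max_cluster (T : finType) (w : {set {set T}}) : nat :=
  \max_(x : T) #|cluster w x|.

Section Percolation.
Variables (R : realType) (T : finType) (e : rel T) (p : R).

Definition weight (w : {set {set T}}) : R :=
  \prod_(b in bonds e) (if b \in w then p else 1 - p).

Definition Expect (X : {set {set T}} -> R) : R :=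
  \sum_(w in powerset (bonds e)) weight w * X w.

Definition Prob (A : pred {set {set T}}) : R :=
  \sum_(w in powerset (bonds e) | A w) weight w.

Definition tau (x y : T) : R := Prob (fun w => connect (occupied w) x y).

Definition chi (o : T) : R := Expect (fun w => #|cluster w o|%:R).

Definition nabla (x y : T) : R :=
  \sum_(u : T) \sum_(v : T) tau x u * tau u v * tau v y.

Definition triangle_condition (a0 : R) : Prop :=
  forall x y : T, nabla x y <= (x == y)%:R + a0.

End Percolation.

Definition lambda_cbrtV (R : realType) (T : finType) (lambda : R) : R :=
  lambda * #|T|%:R `^ 3^-1.

(* [chi] is strictly increasing on [0, 1], from 1 to #|T|, so that at most one
   [pc] satisfies this, and exactly one when 1 < lambda_cbrtV T lambda < #|T|. *)
Definition critical_threshold (R : realType) (T : finType) (e : rel T) (o : T)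
    (lambda pc : R) : Prop :=
  0 <= pc <= 1 /\ chi e pc o = lambda_cbrtV T lambda.

(* Main.v *)
From mathcomp Require Import interval_inference topology normedtype derive realfun.
From mathcomp Require Import ring lra.
Require Import Defs.
From HB Require Import structures.
From mathcomp Require Import all_boot all_order all_algebra all_fingroup.
From mathcomp Require Import reals sequences exp.

Set Implicit Arguments.
Unset Strict Implicit.
Unset Printing Implicit Defensive.

Import Order.TTheory GRing.Theory Num.Theory.
Import numFieldNormedType.Exports.

Local Open Scope ring_scope.

(** The graph is finite, so every quantity is a polynomial in [p], and
    everything rests on three elementary facts about independent bonds.

    (a) A functional van den Berg - Kesten inequality ([bmean_BK]): if a
    function of the configuration is dominated by a monotone [Q S1 S2 S3] for
    some disjoint sets [S1], [S2], [S3] of occupied bonds, then its mean is at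
    most the mean of [Q] over three independent configurations.  Two vertices
    [x], [y] of the cluster of [o] are joined to [o] by a tripod with disjoint
    legs, and the three legs can be enlarged until they absorb the whole cluster
    ([median]).  With [C] the cluster of [o] this yields, for every monotone
    weight [h], a bound on the mean of [|C|^2 h(|C|)] in terms of three
    independent clusters ([weighted_square_le]).  For [h = 1] and [h(n) = n] it
    gives [E|C|^2 <= chi^3] and [E|C|^3 <= 3 chi^5].  For [h(n) = exp(tn)] it
    says that [m(t) = E(|C| exp(t|C|))] satisfies [m' <= m^3], hence
    [m(t) <= chi (1 - 2 t chi^2)^(-1/2)].

    (b) The derivative of [chi] is [Omega] times the average over the bonds of
    the mean of [|C(u)| |C(v)|] on the event that the ends [u], [v] of the bond
    are not connected off that bond.  This mean is at most [chi^2] by (a).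
    Exploring the cluster of [u] first and bounding what it hides from [v] shows
    that it is at least [chi^2 (1 - nabla(u,v))].  So
    [(1 - a0) Omega chi^2 <= chi' <= Omega chi^2], and integrating [1/chi] gives
    part (i).

    (c) [p (1 - p) chi'] is the covariance of [|C|] with the sum [N] of the
    centred states of the bonds touching [C].  The terms of [N] are uncorrelated,
    so [E(N^2) <= p (1 - p) Omega chi], and Cauchy - Schwarz turns the lower
    bound on [chi'] into [E|C|^2 >= (1 - a0)^2 Omega p (1 - p) chi^3].  Here
    [Omega p >= 1 - 1/chi] by (b), and [p <= a0] because a bond is a connection.

    Upper bounds in (ii): the largest cluster [M] satisfies
    [E(M^2 exp(tM)) <= V m(t)], and a Chernoff bound at
    [t = 1/(2 chi^2) - 1/(2k)] controls both [P(M > k)] and [E M].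
    Lower bounds in (ii): the second and third moments force
    [P(|C| >= chi^2/16) >= 1/(90 chi)] once [chi >= 4]; applied at a smaller
    parameter [q], chosen so that [chi(q)^2 = 16 k], this becomes
    [P(|C| >= k) >= 1/(360 sqrt k)] for every [k] between [1] and [chi^2/16], and
    the second moment method for the number of vertices in clusters of size at
    least [k] concludes.  The logarithm is large
    because summing the triangle condition over [y] gives
    [chi(pc)^3 <= 1 + a0 V]. *)

(** * Means over independent bonds *)

Section ProductMeasure.
Variables (R : realType) (U : finType).
Implicit Types (p c : R) (s : seq U) (b : U) (w : {set U}).
Implicit Types (f g : {set U} -> R).

(** The mean of [f] when each element of [s] is occupied with probability [p]. The
    recursion on the list of bonds lets every property be proved one bond at a time. *)
Fixpoint bmean p s f : R :=
  if s is b :: s' then p * bmean p s' (fun w => f (b |: w)) + (1 - p) * bmean p s' f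
  else f set0.

Lemma bmean_ext p s f g :
  (forall w, {subset w <= s} -> f w = g w) -> bmean p s f = bmean p s g.
Proof.
elim: s f g => [|b s IHs] f g fg /=; first by apply: fg => x; rewrite inE.
rewrite (IHs _ (fun w => g (b |: w))) => [|w ws]; last first.
  by apply: fg => x; rewrite !inE => /orP[->//|/ws ->]; rewrite orbT.
by rewrite (IHs f g) // => w ws; apply: fg => x /ws xs; rewrite inE xs orbT.
Qed.

Lemma eq_bmean p s f g : f =1 g -> bmean p s f = bmean p s g.
Proof. by move=> fg; apply: bmean_ext => w _. Qed.

Lemma bmeanD p s f g : bmean p s (fun w => f w + g w) = bmean p s f + bmean p s g.
Proof. by elim: s f g => [|b s IHs] f g //=; rewrite !IHs; ring. Qed.

Lemma bmeanZ p s c f : bmean p s (fun w => c * f w) = c * bmean p s f.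
Proof. by elim: s f => [|b s IHs] f //=; rewrite !IHs; ring. Qed.

Lemma bmeanZr p s c f : bmean p s (fun w => f w * c) = bmean p s f * c.
Proof. by rewrite mulrC -bmeanZ; apply: eq_bmean => w; rewrite mulrC. Qed.

Lemma bmean_cst p s c : bmean p s (fun=> c) = c.
Proof. by elim: s => [|b s IHs] //=; rewrite !IHs; ring. Qed.

Lemma bmeanN p s f : bmean p s (fun w => - f w) = - bmean p s f.
Proof. by rewrite -mulN1r -bmeanZ; apply: eq_bmean => w; rewrite mulN1r. Qed.

Lemma bmeanB p s f g : bmean p s (fun w => f w - g w) = bmean p s f - bmean p s g.
Proof. by rewrite bmeanD bmeanN. Qed.

Lemma bmean_sum (I : Type) (r : seq I) (P : pred I) p s (F : I -> {set U} -> R) :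
  bmean p s (fun w => \sum_(i <- r | P i) F i w) = \sum_(i <- r | P i) bmean p s (F i).
Proof.
elim: r => [|i r IHr].
  by rewrite big_nil -[RHS](bmean_cst p s); apply: eq_bmean => w; rewrite big_nil.
rewrite big_cons -IHr; case: ifP => Pi; rewrite -?bmeanD; apply: eq_bmean => w;
  by rewrite big_cons Pi.
Qed.

Lemma bmean_cons p b s f :
  bmean p (b :: s) f = bmean p s (fun w => p * f (b |: w) + (1 - p) * f w).
Proof. by rewrite bmeanD !bmeanZ. Qed.

Lemma bmean_le_on p s f g : 0 <= p <= 1 ->
  (forall w, {subset w <= s} -> f w <= g w) -> bmean p s f <= bmean p s g.
Proof.
move=> /andP[p0 p1]; elim: s f g => [|b s IHs] f g fg /=.
  by apply: fg => x; rewrite inE.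
apply: lerD; apply: ler_wpM2l; rewrite ?subr_ge0 //; apply: IHs => w ws; apply: fg => x.
  by rewrite !inE => /orP[->//|/ws ->]; rewrite orbT.
by rewrite inE => /ws ->; rewrite orbT.
Qed.

Lemma bmean_le p s f g : 0 <= p <= 1 -> (forall w, f w <= g w) -> bmean p s f <= bmean p s g.
Proof. by move=> p01 fg; apply: bmean_le_on => // w _. Qed.

Lemma bmean_ge0 p s f : 0 <= p <= 1 -> (forall w, 0 <= f w) -> 0 <= bmean p s f.
Proof. by move=> p01 f0; rewrite -(bmean_cst p s 0); apply: bmean_le. Qed.

(** Conditioning on the state of one bond, wherever it is in the list. *)
Lemma bmean_flip p s b f : uniq s -> b \in s ->
  bmean p s f = p * bmean p s (fun w => f (b |: w)) + (1 - p) * bmean p s (fun w => f (w :\ b)).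
Proof.
elim: s f => [|c s IHs] f //= /andP[cs us]; rewrite inE.
case: (eqVneq b c) cs => [<-{c}|neq_bc] cs /= bs.
  have -> : bmean p s (fun w => f (b |: (b |: w))) = bmean p s (fun w => f (b |: w)).
    by apply: eq_bmean => w; rewrite setUA setUid.
  have -> : bmean p s (fun w => f ((b |: w) :\ b)) = bmean p s f.
    by apply: bmean_ext => w ws; rewrite setU1K //; apply: contra cs; apply: ws.
  have -> : bmean p s (fun w => f (w :\ b)) = bmean p s f.
    apply: bmean_ext => w ws; congr (f _); apply/setDidPl; rewrite disjoint_sym disjoints1.
    by apply: contra cs; apply: ws.
  ring.
rewrite (IHs (fun w => f (c |: w)) us bs) (IHs f us bs).
have -> : bmean p s (fun w => f (c |: (b |: w))) = bmean p s (fun w => f (b |: (c |: w))).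
  by apply: eq_bmean => w; rewrite setUCA.
have -> : bmean p s (fun w => f (c |: w :\ b)) = bmean p s (fun w => f ((c |: w) :\ b)).
  apply: eq_bmean => w; congr (f _); apply/setP => x; rewrite !inE.
  by have [->|//] := eqVneq x c; rewrite eq_sym neq_bc.
ring.
Qed.

(** The state of [b] is independent of the other bonds, so only the dependence of
    [f] on [b] contributes to this covariance; [p (1 - p)] is the variance of the
    state of [b]. *)
Lemma bmean_score p s b f : uniq s -> b \in s ->
  bmean p s (fun w => f w * ((b \in w)%:R - p)) =
  p * (1 - p) * bmean p s (fun w => f (b |: w) - f (w :\ b)).
Proof.
move=> us bs; rewrite (bmean_flip p _ us bs) bmeanB.
have -> : bmean p s (fun w => f (b |: w) * ((b \in b |: w)%:R - p)) =
          bmean p s (fun w => f (b |: w)) * (1 - p).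
  by rewrite -bmeanZr; apply: eq_bmean => w; rewrite setU11.
have -> : bmean p s (fun w => f (w :\ b) * ((b \in w :\ b)%:R - p)) =
          bmean p s (fun w => f (w :\ b)) * (- p).
  by rewrite -bmeanZr; apply: eq_bmean => w; rewrite setD11 sub0r.
ring.
Qed.

(** Independence of disjoint sets of bonds: in the induction each bond is invisible
    to one of the two factors. *)
Lemma bmean_indep p s (K : {set U}) f g :
  (forall w, f w = f (w :&: K)) -> (forall w, g w = g (w :\: K)) ->
  bmean p s (fun w => f w * g w) = bmean p s f * bmean p s g.
Proof.
elim: s f g => [|b s IHs] f g fK gK //=.
rewrite (IHs f g) //.
have eqfK w : f (b |: w) = f (b |: (w :&: K)).
  rewrite fK setIUl [in RHS]fK setIUl -[in RHS]setIA setIid //.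
have eqgK w : g (b |: w) = g (b |: (w :\: K)).
  by rewrite gK setDUl [in RHS]gK setDUl setDDl setUid.
rewrite (IHs (fun w => f (b |: w)) (fun w => g (b |: w))) //.
have [bK|bK] := boolP (b \in K).
  have -> : bmean p s (fun w => g (b |: w)) = bmean p s g.
    apply: eq_bmean => w; rewrite gK [in RHS]gK setDUl.
    by rewrite (_ : [set b] :\: K = set0) ?set0U //; apply/eqP; rewrite setD_eq0 sub1set.
  ring.
have -> : bmean p s (fun w => f (b |: w)) = bmean p s f.
  apply: eq_bmean => w; rewrite fK [in RHS]fK setIUl.
  rewrite (_ : [set b] :&: K = set0) ?set0U //; apply/eqP.
  by rewrite setI_eq0 disjoints1.
ring.
Qed.

(** Russo's formula. It holds for every real [p], which spares one-sided
    derivatives at the ends of the unit interval. *)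
Lemma bmean_derive p s f : uniq s ->
  is_derive p (1 : R) (fun q => bmean q s f)
    (\sum_(b <- s) bmean p s (fun w => f (b |: w) - f (w :\ b))).
Proof.
elim: s f => [|b s IHs] f /=; first by rewrite big_nil => _; apply: is_derive_cst.
move=> /andP[bs us].
have D1 := IHs (fun w => f (b |: w)) us; have D2 := IHs f us.
have D0 := is_derive_id p (1 : R).
have D3 : is_derive p (1 : R) (fun q : R => 1 - q) (- 1).
  by have := is_deriveB (is_derive_cst (1 : R) p (1 : R)) D0; rewrite sub0r.
have := is_deriveD (is_deriveM D0 D1) (is_deriveM D3 D2).
congr is_derive; rewrite big_cons.
have -> : bmean p s (fun w => f (b |: (b |: w)) - f ((b |: w) :\ b)) =
          bmean p s (fun w => f (b |: w)) - bmean p s f.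
  rewrite -bmeanB; apply: bmean_ext => w ws; rewrite setUA setUid setU1K //.
  by apply: contra bs; apply: ws.
have -> : bmean p s (fun w => f (b |: w) - f (w :\ b)) =
          bmean p s (fun w => f (b |: w)) - bmean p s f.
  rewrite -bmeanB; apply: bmean_ext => w ws; congr (_ - f _).
  apply/setDidPl; rewrite disjoint_sym disjoints1.
  by apply: contra bs; apply: ws.
rewrite big_split /= -!mulr_sumr.
have -> : \sum_(c <- s) bmean p s (fun w => f (c |: (b |: w)) - f ((b |: w) :\ c)) =
          \sum_(c <- s) bmean p s (fun w => f (b |: (c |: w)) - f (b |: w :\ c)).
  rewrite big_seq [RHS]big_seq; apply: eq_bigr => c cs; apply: eq_bmean => w.
  rewrite setUCA; congr (_ - f _); apply/setP => x; rewrite !inE.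
  have [->|//] := eqVneq x c; rewrite /= ?orbF.
  by apply/esym; apply: contraNF bs => /eqP <-.
rewrite /GRing.scale /=.
ring.
Qed.

Lemma bmean_param_derive (f f' : R -> {set U} -> R) p s t :
  (forall w, is_derive t (1 : R) (fun u => f u w) (f' t w)) ->
  is_derive t (1 : R) (fun u => bmean p s (f u)) (bmean p s (f' t)).
Proof.
elim: s f f' => [|b s IHs] f f' df /=; first exact: df.
have D1 := IHs (fun u w => f u (b |: w)) (fun u w => f' u (b |: w)) (fun w => df _).
have D2 := IHs f f' df.
exact: (is_deriveD (is_deriveZ p D1) (is_deriveZ (1 - p) D2)).
Qed.

Lemma bmean_mono p q s f : 0 <= p -> p <= q -> q <= 1 ->
  (forall w w', w \subset w' -> f w <= f w') -> bmean p s f <= bmean q s f.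
Proof.
move=> p0 pq q1; elim: s f => [|b s IHs] f fmono //=.
have H1 : bmean p s (fun w => f (b |: w)) <= bmean q s (fun w => f (b |: w)).
  by apply: IHs => w w' ww'; apply: fmono; apply: setUS.
have H2 := IHs f fmono.
have H3 : bmean q s f <= bmean q s (fun w => f (b |: w)).
  apply: bmean_le; first by rewrite (le_trans p0 pq).
  by move=> w; apply: fmono; apply: subsetUr.
nra.
Qed.

(** * Disjoint occurrence *)

Definition mono3 (Q : {set U} -> {set U} -> {set U} -> R) :=
  forall S1 S1' S2 S2' S3 S3' : {set U}, S1 \subset S1' -> S2 \subset S2' -> S3 \subset S3' ->
    Q S1 S2 S3 <= Q S1' S2' S3'.

Definition disjoint3 (w S1 S2 S3 : {set U}) : Prop :=
  [/\ [/\ S1 \subset w, S2 \subset w & S3 \subset w],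
      S1 :&: S2 = set0, S1 :&: S3 = set0 & S2 :&: S3 = set0].

(** The van den Berg - Kesten inequality, for functions instead of events. Bonds are
    split one after the other into three independent copies. At most one of the
    disjoint sets uses the bond [b], so [g] with [b] occupied is dominated by the
    largest value [Q'] obtained by giving [b] to a single set. By monotonicity, the
    mean of [Q] over the three copies of [b] is at least the mean over the copy that
    realizes this maximum, with the other two vacant. *)
Lemma bmean_BK p s (Q : {set U} -> {set U} -> {set U} -> R) g :
  0 <= p <= 1 -> mono3 Q ->
  (forall w, exists S1 S2 S3, disjoint3 w S1 S2 S3 /\ g w <= Q S1 S2 S3) ->
  bmean p s g <= bmean p s (fun w1 => bmean p s (fun w2 => bmean p s (fun w3 => Q w1 w2 w3))).
Proof.
move=> p01; have /andP[p0 p1] := p01.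
elim: s Q g => [|b s IHs] Q g monoQ gQ.
  rewrite /=; have [S1 [S2 [S3 [[[s1 s2 s3] _ _ _] /le_trans->//]]]] := gQ set0.
  exact: monoQ.
pose Q' w1 w2 w3 := Num.max (Q (b |: w1) w2 w3)
                     (Num.max (Q w1 (b |: w2) w3) (Q w1 w2 (b |: w3))).
have monoQ' : mono3 Q'.
  move=> A A' B B' C C' AA BB CC; rewrite /Q' !ge_max !le_max.
  by apply/and3P; split; apply/or3P; [apply: Or31|apply: Or32|apply: Or33];
    apply: monoQ; rewrite ?setUS.
have gQ' w : exists S1 S2 S3, disjoint3 w S1 S2 S3 /\ g (b |: w) <= Q' S1 S2 S3.
  have [S1 [S2 [S3 [[[s1 s2 s3] d12 d13 d23] gle]]]] := gQ (b |: w).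
  have subw (S : {set U}) : S \subset b |: w -> S :\ b \subset w by rewrite subDset.
  have disj (A B : {set U}) : A :&: B = set0 -> (A :\ b) :&: (B :\ b) = set0.
    move=> AB; apply/eqP; rewrite -subset0 -AB; apply: setISS; exact: subsetDl.
  have bU (A : {set U}) : A \subset b |: (A :\ b) by rewrite -subDset.
  have nb (A : {set U}) : b \notin A -> A \subset A :\ b.
    by move=> bA; rewrite subsetD1 subxx.
  have ndisj (A B : {set U}) : A :&: B = set0 -> b \in A -> b \notin B.
    by move=> AB bA; apply/negP => bB; have := in_set0 b; rewrite -AB inE bA bB.
  exists (S1 :\ b), (S2 :\ b), (S3 :\ b); split.
    by split; [split; apply: subw | apply: disj..].
  apply: (le_trans gle); rewrite /Q' !le_max.
  have [b1|b1] := boolP (b \in S1).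
    by apply/orP; left; apply: monoQ => //; apply: nb;
      [apply: (ndisj S1) d12 _|apply: (ndisj S1) d13 _].
  have [b2|b2] := boolP (b \in S2).
    by apply/or3P; apply: Or32; apply: monoQ => //; apply: nb => //;
      apply: (ndisj S2) d23 _.
  by apply/or3P; apply: Or33; apply: monoQ => //; apply: nb.
have mix x y z : z <= x -> z <= y -> z <= p * x + (1 - p) * y by move=> *; nra.
have lemix x y x' y' : x <= x' -> y <= y' -> p * x + (1 - p) * y <= p * x' + (1 - p) * y'.
  by move=> *; nra.
have dU (A : {set U}) : A \subset b |: A by apply: subsetUr.
rewrite [bmean p _ g]/=.
(* Compare with the state in which only one of the three copies of [b] is used. *)
apply: (@le_trans _ _ (bmean p s (fun w1 => bmean p s (fun w2 => bmean p s (fun w3 =>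
   p * Q' w1 w2 w3 + (1 - p) * Q w1 w2 w3))))).
  have -> : bmean p s (fun w1 => bmean p s (fun w2 => bmean p s (fun w3 =>
     p * Q' w1 w2 w3 + (1 - p) * Q w1 w2 w3))) =
     p * bmean p s (fun w1 => bmean p s (fun w2 => bmean p s (fun w3 => Q' w1 w2 w3))) +
     (1 - p) * bmean p s (fun w1 => bmean p s (fun w2 => bmean p s (fun w3 => Q w1 w2 w3))).
    rewrite -!bmeanZ -bmeanD; apply: eq_bmean => w1.
    rewrite -!bmeanZ -bmeanD; apply: eq_bmean => w2.
    by rewrite -!bmeanZ -bmeanD; apply: eq_bmean => w3.
  by apply: lemix; apply: IHs.
rewrite bmean_cons; apply: bmean_le => // w1.
rewrite !bmean_cons -!bmeanZ -bmeanD; apply: bmean_le => // w2.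
rewrite !bmean_cons -!bmeanZ -bmeanD -!bmeanZ -bmeanD -!bmeanZ -bmeanD; apply: bmean_le => // w3.
rewrite /Q'; set M := Num.max _ _.
have [h|h] : M = Q (b |: w1) w2 w3 \/ M = Q w1 (b |: w2) w3 \/ M = Q w1 w2 (b |: w3).
- by rewrite /M; case: leP => _; [right; case: leP => _; [right|left]|left].
- rewrite h; apply: lemix; apply: (mix); apply: mix; exact: monoQ.
case: h => h; rewrite h; apply: (mix).
- apply: lemix; apply: mix; exact: monoQ.
- apply: lemix; apply: mix; exact: monoQ.
- by apply: mix; apply: lemix; exact: monoQ.
- by apply: mix; apply: lemix; exact: monoQ.
Qed.

End ProductMeasure.

(** * Clusters and disjoint connections *)

Section Clusters.
Variable T : finType.
Implicit Types (w S : {set {set T}}) (A : {set T}) (a b o u v x y z : T).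

Lemma occupied_sym w : symmetric (occupied w).
Proof. by move=> x y; rewrite /occupied setUC. Qed.

Lemma occupied_connect_sym w : connect_sym (occupied w).
Proof. exact/sym_connect_sym/occupied_sym. Qed.

Lemma mem_cluster w o : o \in cluster w o.
Proof. by rewrite inE. Qed.

Lemma cluster_sym w x y : (x \in cluster w y) = (y \in cluster w x).
Proof. by rewrite !inE occupied_connect_sym. Qed.

Lemma cluster_eq w x y : y \in cluster w x -> cluster w y = cluster w x.
Proof.
rewrite inE => xy; apply/setP => z; rewrite !inE.
by apply/esym/same_connect => //; exact: occupied_connect_sym.
Qed.

Lemma cluster_step w o a b : a \in cluster w o -> [set a; b] \in w -> b \in cluster w o.
Proof. by rewrite !inE => oa ab; apply: connect_trans oa _; apply: connect1. Qed.

(** The way to bound a cluster from above: a set that no occupied bond leaves. *)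
Lemma cluster_closed w o A : o \in A ->
  (forall a b, a \in A -> b \notin A -> [set a; b] \notin w) -> cluster w o \subset A.
Proof.
move=> oA clA; apply/subsetP => x; rewrite inE => /connectP[q].
elim: q o oA => [|y q IHq] o oA /=; first by move=> _ ->.
move=> /andP[oy yq] xE; apply: (IHq y) => //.
by apply/negPn/negP => yA; move/negP: (clA _ _ oA yA).
Qed.

Lemma cluster_mono w w' o : w \subset w' -> cluster w o \subset cluster w' o.
Proof.
move=> ww'; apply: cluster_closed => [|a b ao]; first exact: mem_cluster.
by apply: contra => /(subsetP ww'); apply: cluster_step.
Qed.

Lemma cluster_set0 o : cluster set0 o = [set o].
Proof.
apply/eqP; rewrite eqEsubset sub1set mem_cluster andbT.
by apply: cluster_closed => [|a b]; rewrite ?inE.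
Qed.

(** Induction along the growth of a spanning tree [S] of the cluster of [o]; the new
    bond is never in [S], which is what keeps connections disjoint. *)
Lemma grow_ind w o (P : {set {set T}} -> {set T} -> Prop) :
  P set0 [set o] ->
  (forall S A a b, P S A -> a \in A -> b \notin A -> [set a; b] \in w ->
     [set a; b] \notin S -> A \subset cluster S o ->
     P ([set a; b] |: S) (b |: A)) ->
  exists2 S : {set {set T}}, S \subset w & P S (cluster w o).
Proof.
move=> P0 PS.
pose Inv (S : {set {set T}}) (A : {set T}) := [/\ S \subset w, o \in A, A \subset cluster S o,
  forall c, c \in S -> c \subset A & P S A].
have main n : (exists2 S : {set {set T}}, S \subset w & P S (cluster w o)) \/
              (exists S A, Inv S A /\ n <= #|A|)%N.
  elim: n => [|n [?|[S [A [[Sw oA AS Sin PSA] nA]]]]]; [right|by left|].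
    exists set0, [set o]; split=> //; split; rewrite ?sub0set ?set11 //.
      by rewrite cluster_set0.
    by move=> c; rewrite inE.
  have [/existsP[a /existsP[b /and3P[aA bA abw]]]|] :=
    boolP [exists a, exists b, [&& a \in A, b \notin A & [set a; b] \in w]].
    have abS : [set a; b] \notin S.
      by apply/negP => /Sin; rewrite subUset !sub1set (negbTE bA) andbF.
    right; exists ([set a; b] |: S), (b |: A); split; last by rewrite cardsU1 bA.
    have AS' : A \subset cluster ([set a; b] |: S) o.
      by apply: subset_trans AS (cluster_mono _ (subsetUr _ _)).
    split.
    - by rewrite subUset sub1set abw.
    - by rewrite inE oA orbT.
    - rewrite subUset AS' sub1set andbT; apply: (@cluster_step _ _ a).
        exact: (subsetP AS').
      exact: setU11.
    - move=> c; rewrite !inE => /orP[/eqP ->|/Sin cA].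
        by rewrite subUset !sub1set !inE eqxx aA orbT.
      by apply: subset_trans cA (subsetUr _ _).
    - exact: PS.
  rewrite negb_exists => /forallP closedA; left; exists S => //.
  suff <- : A = cluster w o by [].
  apply/eqP; rewrite eqEsubset (subset_trans AS (cluster_mono _ Sw)) /=.
  apply: cluster_closed => // a b aA bA; have := closedA a.
  by rewrite negb_exists => /forallP/(_ b); rewrite aA bA.
have [//|[S [A [_]]]] := main #|T|.+1.
by rewrite ltnNge max_card.
Qed.

(** When a bond from [a] to [b] is added to the tree, it joins the leg that contains
    [a]; this extends the legs for the old pairs [x], [y] as well as for the pairs
    with [x = b] or [y = b]. For [x = y = b] the tripod degenerates to its centre
    [b], with the whole tree as its first leg. *)
Lemma median w o x y : x \in cluster w o -> y \in cluster w o ->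
  exists z S1 S2 S3, [/\ disjoint3 w S1 S2 S3,
    [/\ z \in cluster S1 o, x \in cluster S2 z & y \in cluster S3 z] &
    cluster w o \subset cluster S1 o :|: cluster S2 z :|: cluster S3 z].
Proof.
pose P (S : {set {set T}}) (A : {set T}) := forall x y, x \in A -> y \in A ->
  exists z S1 S2 S3, [/\ disjoint3 S S1 S2 S3,
    [/\ z \in cluster S1 o, x \in cluster S2 z & y \in cluster S3 z] &
    A \subset cluster S1 o :|: cluster S2 z :|: cluster S3 z].
suff [S Sw PS] : exists2 S : {set {set T}}, S \subset w & P S (cluster w o).
  move=> xw yw; have [z [S1 [S2 [S3 [[[s1 s2 s3] d12 d13 d23] conn cov]]]]] := PS x y xw yw.
  by exists z, S1, S2, S3; split=> //; split=> //; split; apply: subset_trans Sw.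
apply: grow_ind => {x y} [x y /set1P -> /set1P ->|S A a b PSA aA bA abw abS AS x y].
  exists o, set0, set0, set0; split.
  - by split; rewrite ?setI0 //; split; apply: sub0set.
  - by rewrite cluster_set0 set11.
  - by rewrite cluster_set0 !setUid.
have grow1 S1 S2 S3 : disjoint3 S S1 S2 S3 -> disjoint3 ([set a; b] |: S) ([set a; b] |: S1) S2 S3.
  move=> [[s1 s2 s3] d12 d13 d23]; split; first split; rewrite ?setUS //.
  - by apply: subset_trans s2 (subsetUr _ _).
  - by apply: subset_trans s3 (subsetUr _ _).
  - rewrite setIUl d12 setU0; apply/eqP; rewrite setI_eq0 disjoints1.
    by apply: contra abS => /(subsetP s2).
  - rewrite setIUl d13 setU0; apply/eqP; rewrite setI_eq0 disjoints1.
    by apply: contra abS => /(subsetP s3).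
have perm1 (w' : {set {set T}}) S1 S2 S3 : disjoint3 w' S1 S2 S3 -> disjoint3 w' S2 S1 S3.
  by move=> [[s1 s2 s3] d12 d13 d23]; split=> //; rewrite setIC.
have perm2 (w' : {set {set T}}) S1 S2 S3 : disjoint3 w' S1 S2 S3 -> disjoint3 w' S1 S3 S2.
  by move=> [[s1 s2 s3] d12 d13 d23]; split=> //; rewrite setIC.
have grow2 S1 S2 S3 : disjoint3 S S1 S2 S3 -> disjoint3 ([set a; b] |: S) S1 ([set a; b] |: S2) S3.
  by move=> /perm1/grow1/perm1.
have grow3 S1 S2 S3 : disjoint3 S S1 S2 S3 -> disjoint3 ([set a; b] |: S) S1 S2 ([set a; b] |: S3).
  by move=> /perm2/grow2/perm2.
have stepb (S' : {set {set T}}) z : a \in cluster S' z -> b \in cluster ([set a; b] |: S') z.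
  move=> az; apply: (@cluster_step _ _ a); last exact: setU11.
  by apply: (subsetP (cluster_mono _ (subsetUr _ _))) az.
have mon (S' : {set {set T}}) z t : t \in cluster S' z -> t \in cluster ([set a; b] |: S') z.
  by apply/subsetP/cluster_mono/subsetUr.
have monS (S' : {set {set T}}) z : cluster S' z \subset cluster ([set a; b] |: S') z.
  by apply/cluster_mono/subsetUr.
rewrite !in_setU1 => /predU1P[->|xA] /predU1P[->|yA].
- exists b, ([set a; b] |: S), set0, set0; split.
  + by split; rewrite ?setI0 //; split; rewrite ?sub0set.
  + by rewrite cluster_set0 set11; split=> //; apply: stepb; apply: (subsetP AS).
  + rewrite -setUA; apply: subset_trans (subsetUl _ _).
    rewrite subUset sub1set stepb ?(subsetP AS) //=.
    by apply: subset_trans AS _.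
- have [z [S1 [S2 [S3 [sp [c1 c2 c3] cov]]]]] := PSA a y aA yA.
  exists z, S1, ([set a; b] |: S2), S3; split; [exact: grow2|by split=> //; apply: stepb|].
  rewrite subUset sub1set !inE; have := stepb _ _ c2; rewrite inE => ->; rewrite orbT /=.
  by apply: subset_trans cov _; rewrite setSU // setUS.
- have [z [S1 [S2 [S3 [sp [c1 c2 c3] cov]]]]] := PSA x a xA aA.
  exists z, S1, S2, ([set a; b] |: S3); split; [exact: grow3|by split=> //; apply: stepb|].
  rewrite subUset sub1set !inE; have := stepb _ _ c3; rewrite inE => ->; rewrite orbT /=.
  by apply: subset_trans cov _; rewrite setUS.
- have [z [S1 [S2 [S3 [sp [c1 c2 c3] cov]]]]] := PSA x y xA yA.
  have /setUP[/setUP[] |] := subsetP cov a aA => ca; have := stepb _ _ ca; rewrite inE => cb.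
  + exists z, ([set a; b] |: S1), S2, S3; split; [exact: grow1|by split=> //; apply: mon|].
    rewrite subUset sub1set !inE cb /=.
    by apply: subset_trans cov _; rewrite setSU // setSU.
  + exists z, S1, ([set a; b] |: S2), S3; split; [exact: grow2|by split=> //; apply: mon|].
    rewrite subUset sub1set !inE cb orbT /=.
    by apply: subset_trans cov _; rewrite setSU // setUS.
  + exists z, S1, S2, ([set a; b] |: S3); split; [exact: grow3|by split=> //; apply: mon|].
    rewrite subUset sub1set !inE cb !orbT /=.
    by apply: subset_trans cov _; rewrite setUS.
Qed.

Definition bonds_off (A : {set T}) w := [set c in w | [disjoint c & A]].

(** A connection from [v] to [x] that is broken by closing the bonds touching [A]
    must visit [A]; cut it at such a vertex [z]. The third set is empty so that
    the three-set form of disjoint occurrence applies. *)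
Lemma through_set w A v x : x \in cluster w v ->
  v \in A \/ x \notin cluster (bonds_off A w) v ->
  exists z S1 S2, [/\ disjoint3 w S1 S2 set0, z \in A, z \in cluster S1 v & x \in cluster S2 z].
Proof.
pose P (S : {set {set T}}) (C : {set T}) :=
  forall x, x \in C -> v \in A \/ x \notin cluster (bonds_off A w) v ->
  exists z S1 S2, [/\ disjoint3 S S1 S2 set0, z \in A, z \in cluster S1 v & x \in cluster S2 z].
suff [S Sw PS] : exists2 S : {set {set T}}, S \subset w & P S (cluster w v).
  move=> xw bad; have [z [S1 [S2 [[[s1 s2 s3] d12 d13 d23] zA c1 c2]]]] := PS x xw bad.
  by exists z, S1, S2; split=> //; split=> //; split=> //; rewrite ?(subset_trans _ Sw) ?sub0set.
apply: grow_ind => {x} [x /set1P -> [vA|]|S C a b PSC aC bC abw abS CS x].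
- exists v, set0, set0; rewrite cluster_set0 set11 vA; split=> //.
  by split; rewrite ?setI0 //; split; apply: sub0set.
- by rewrite mem_cluster.
have SS' : S \subset [set a; b] |: S by apply: subsetUr.
rewrite in_setU1 => /predU1P[-> bad|xC bad]; last first.
  have [z [S1 [S2 [[[s1 s2 s3] d12 d13 d23] zA c1 c2]]]] := PSC x xC bad.
  exists z, S1, S2; split=> //; split=> //; split; rewrite ?sub0set //.
    exact: subset_trans SS'.
  exact: subset_trans SS'.
have [abad|agood] := boolP ((v \in A) || (a \notin cluster (bonds_off A w) v)).
  have [z [S1 [S2 [[[s1 s2 s3] d12 d13 d23] zA c1 c2]]]] := PSC a aC (orP abad).
  exists z, S1, ([set a; b] |: S2); split=> //; last first.
    apply: (@cluster_step _ _ a); last exact: setU11.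
    by apply: (subsetP (cluster_mono _ (subsetUr _ _))) c2.
  split; rewrite ?setI0 //.
    by split; rewrite ?sub0set ?setUS //; apply: subset_trans SS'.
  rewrite setIUr d12 setU0; apply/eqP; rewrite setIC setI_eq0 disjoints1.
  by apply: contra abS => /(subsetP s1).
move: agood bad; rewrite negb_or negbK => /andP[vA av] [/idPn//|bv].
have aA : a \notin A.
  have vC : v \in ~: A by rewrite inE.
  have /subsetP/(_ a av) : cluster (bonds_off A w) v \subset ~: A.
    apply: cluster_closed => // c d; rewrite !inE negbK => cA dA.
    rewrite negb_and disjoint_sym -setI_eq0; apply/orP; right; apply/set0Pn; exists d.
    by rewrite !inE eqxx orbT dA.
  by rewrite inE.
have bA : b \in A.
  apply: contraNT bv => bA; apply: (@cluster_step _ _ a) => //.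
  rewrite inE abw /= disjoint_sym disjoint_subset; apply/subsetP => c cA.
  by rewrite !inE negb_or; apply/andP; split; apply: contraTneq cA => ->.
exists b, ([set a; b] |: S), set0; split=> //.
- by split; rewrite ?setI0 //; split; rewrite ?sub0set.
- apply: (@cluster_step _ _ a); last exact: setU11.
  by apply: (subsetP (cluster_mono _ SS')); apply: (subsetP CS).
- by rewrite cluster_set0 set11.
Qed.

End Clusters.

(** * The percolation measure *)

Section PowersetMean.
Variables (R : realType) (U : finType).
Implicit Types (p : R) (s : seq U) (w : {set U}) (f : {set U} -> R).

Lemma bmean_powerset p s f : uniq s ->
  \sum_(w in powerset [set x in s]) (\prod_(b <- s) (if b \in w then p else 1 - p)) * f w
  = bmean p s f.
Proof.
elim: s f => [|b s IHs] f /=.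
  move=> _; rewrite (_ : [set x in [::]] = set0); last by apply/setP => x; rewrite !inE.
  by rewrite powerset0 big_set1 big_nil mul1r.
move=> /andP[bs us]; rewrite -(IHs f us) -(IHs (fun w => f (b |: w)) us).
rewrite !mulr_sumr (bigID (fun w : {set U} => b \in w)) /=; congr (_ + _).
  rewrite (reindex_onto (fun w : {set U} => b |: w) (fun w : {set U} => w :\ b)) /=; last first.
    by move=> w /andP[_ bw]; rewrite setD1K.
  apply: eq_big => w.
    rewrite setU11 andbT !powersetE; apply/andP/idP => [[sub /eqP eqw]|sub].
      apply/subsetP => x xw; move: (subsetP sub x); rewrite !inE xw orbT => /(_ isT).
      by case/predU1P => // xb; move: xw; rewrite -eqw xb !inE eqxx.
    rewrite setU1K; last by apply: contra bs => /(subsetP sub); rewrite inE.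
    split=> //; rewrite subUset sub1set !inE eqxx /=.
    by apply: subset_trans sub _; apply/subsetP => x; rewrite !inE => ->; rewrite orbT.
  rewrite andbC; move=> /andP[_ _].
  rewrite big_cons setU11 -!mulrA; congr (_ * (_ * _)).
  rewrite big_seq [RHS]big_seq; apply: eq_bigr => c cs; rewrite !inE.
  by case: eqVneq cs bs => [->|//] ->.
apply: eq_big => w.
  rewrite !powersetE; apply/andP/idP => [[sub bw]|sub].
    apply/subsetP => x xw; move: (subsetP sub x xw); rewrite !inE.
    by case/predU1P => // xb; move: bw; rewrite -xb xw.
  split; last by apply: contra bs => /(subsetP sub); rewrite inE.
  by apply: subset_trans sub _; apply/subsetP => x; rewrite !inE => ->; rewrite orbT.
by move=> /andP[_ /negbTE bw]; rewrite big_cons bw mulrA.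
Qed.

End PowersetMean.

Notation bond_mean e p := (bmean p (enum (bonds e))).

Section Graph.
Variables (R : realType) (T : finType) (e : rel T).
Implicit Types (p : R) (f : {set {set T}} -> R).

Lemma ExpectE p f : Expect e p f = bond_mean e p f.
Proof.
rewrite -bmean_powerset ?enum_uniq // /Expect.
rewrite (_ : [set x in enum (bonds e)] = bonds e); last first.
  by apply/setP => x; rewrite inE mem_enum.
by apply: eq_bigr => w _; rewrite /weight big_enum.
Qed.

Lemma ProbE p (A : pred {set {set T}}) : Prob e p A = bond_mean e p (fun w => (A w)%:R).
Proof.
rewrite -ExpectE /Prob /Expect big_mkcondr; apply: eq_bigr => w _.
by case: (A w); rewrite ?mulr1 ?mulr0.
Qed.

Lemma tauE p x y : tau e p x y = bond_mean e p (fun w => (y \in cluster w x)%:R).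
Proof. by rewrite /tau ProbE; apply: eq_bmean => w; rewrite inE. Qed.

Lemma tau_sym p x y : tau e p x y = tau e p y x.
Proof. by rewrite !tauE; apply: eq_bmean => w; rewrite cluster_sym. Qed.

Lemma tau_refl p x : tau e p x x = 1.
Proof.
rewrite tauE -[RHS](bmean_cst p (enum (bonds e))).
by apply: eq_bmean => w; rewrite mem_cluster.
Qed.

Lemma card_sumR (A : {set T}) : #|A|%:R = \sum_(y : T) (y \in A)%:R :> R.
Proof. by rewrite -sum1_card big_mkcond natr_sum; apply: eq_bigr => y _; case: (y \in A). Qed.

Lemma chi_tau p x : chi e p x = \sum_y tau e p x y.
Proof.
rewrite /chi ExpectE (eq_bigr _ (fun y _ => tauE p x y)) -bmean_sum.
by apply: eq_bmean => w; rewrite card_sumR.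
Qed.

Hypothesis simp : simple_graph e.

Lemma bondsP b : reflect (exists u v, [/\ e u v, u != v & b = [set u; v]]) (b \in bonds e).
Proof.
case: simp => _ irr; apply: (iffP imsetP) => [[[u v]]|[u [v [euv _ ->]]]].
  rewrite inE /= => euv ->; exists u, v; split=> //.
  by apply: contraTneq euv => ->; rewrite irr.
by exists (u, v); rewrite ?inE.
Qed.

(** The handshake lemma. *)
Lemma card_bonds : (#|bonds e| * 2 = \sum_x degree e x)%N.
Proof.
case: simp => sym irr.
have -> : (\sum_x degree e x = #|[set u : T * T | e u.1 u.2]|)%N.
  rewrite -sum1dep_card -(pair_big_dep xpredT (fun x y => e x y) (fun _ _ => 1%N)) /=.
  by apply: eq_bigr => x _; rewrite sum1dep_card.
rewrite -[RHS]sum1_card (partition_big_imset (fun u : T * T => [set u.1; u.2])) /=.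
rewrite -/(bonds e) -sum_nat_const; apply/esym; apply: eq_bigr => b.
move=> /imsetP[[u v]]; rewrite inE /= => euv ->.
have neq_uv : u != v by apply: contraTneq euv => ->; rewrite irr.
rewrite sum1dep_card (_ : [set _ | _] = [set (u, v); (v, u)]) ?cards2.
  by rewrite xpair_eqE (negbTE neq_uv).
apply/setP => [[x y]]; rewrite !inE /= !xpair_eqE; apply/andP/orP.
  move=> [exy /eqP eqb]; have : x \in [set u; v] by rewrite -eqb !inE eqxx.
  have : y \in [set u; v] by rewrite -eqb !inE eqxx orbT.
  have : x != y by apply: contraTneq exy => ->; rewrite irr.
  rewrite !inE => nxy /orP[] /eqP ? /orP[] /eqP ?; subst; rewrite ?eqxx //= in nxy *;
    by [left|right].
by case=> /andP[/eqP -> /eqP ->]; rewrite ?euv 1?sym ?euv //; split=> //; rewrite setUC.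
Qed.

Section Automorphism.
Variable (s : {perm T}).
Hypothesis auts : automorphism e s.

Let sB (w : {set {set T}}) : {set {set T}} := [set s @: (b : {set T}) | b in w].

Let sB_inj : injective sB.
Proof. by apply: imset_inj; apply: imset_inj; apply: perm_inj. Qed.

Lemma mem_bonds_aut (b : {set T}) : (s @: b \in bonds e) = (b \in bonds e).
Proof.
apply/bondsP/bondsP => [[u [v [euv nuv bE]]]|[u [v [euv nuv ->]]]]; last first.
  by exists (s u), (s v); rewrite auts (inj_eq perm_inj) imsetU1 imset_set1.
exists (s^-1 u)%g, (s^-1 v)%g; split.
- by rewrite -auts !permKV.
- by rewrite (inj_eq perm_inj).
- apply: (imset_inj (@perm_inj _ s)); apply: (etrans bE).
  by rewrite imsetU1 imset_set1 !permKV.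
Qed.

Lemma cluster_aut w x : cluster (sB w) (s x) = s @: cluster w x.
Proof.
have step w' a b : ([set s a; s b] \in sB w') = ([set a; b] \in w').
  rewrite (_ : [set s a; s b] = s @: [set a; b]) ?(mem_imset _ _ (imset_inj (@perm_inj _ s))) //.
  by rewrite imsetU1 imset_set1.
apply/eqP; rewrite eqEsubset; apply/andP; split.
  apply: cluster_closed => [|a b /imsetP[a' a'x ->]].
    by rewrite (mem_imset _ _ (@perm_inj _ s)) mem_cluster.
  rewrite -[b](permKV s) (mem_imset _ _ (@perm_inj _ s)) step; apply: contra.
  exact: cluster_step a'x.
apply/subsetP => _ /imsetP[y yx ->]; move: yx.
suff : cluster w x \subset [set y | s y \in cluster (sB w) (s x)].
  by move/subsetP/(_ y) => /[apply]; rewrite inE.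
apply: cluster_closed => [|a b]; rewrite !inE ?connect0 // => ax.
apply: contra => ab; have := @cluster_step _ (sB w) (s x) (s a) (s b).
by rewrite !inE step; apply.
Qed.

Lemma mean_aut p f : bond_mean e p f = bond_mean e p (fun w => f (sB w)).
Proof.
rewrite -!ExpectE /Expect.
rewrite (reindex_inj sB_inj) /=; apply: eq_big => w.
  rewrite !powersetE; apply/subsetP/subsetP => sub b bw.
    by rewrite -mem_bonds_aut; apply: sub; apply: imset_f.
  by case/imsetP: bw => c cw ->; rewrite mem_bonds_aut; apply: sub.
move=> _; congr (_ * _); rewrite /weight.
rewrite (reindex_inj (imset_inj (@perm_inj _ s))) /=; apply: eq_big => b.
  by rewrite mem_bonds_aut.
by move=> _; rewrite (mem_imset _ _ (imset_inj (@perm_inj _ s))).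
Qed.

End Automorphism.

Hypothesis trans : transitive_graph e.

(** An automorphism that maps [x] to [y] permutes the bonds, so it preserves the
    product measure. *)
Lemma mean_card_cluster p (h : nat -> R) x y :
  bond_mean e p (fun w => h #|cluster w x|) = bond_mean e p (fun w => h #|cluster w y|).
Proof.
have [s [auts <-]] := trans x y.
rewrite [RHS](mean_aut auts); apply: eq_bmean => w.
by rewrite cluster_aut card_imset //; apply: perm_inj.
Qed.

Lemma chi_trans p x y : chi e p x = chi e p y.
Proof. by rewrite /chi !ExpectE; apply: (mean_card_cluster p (fun n => n%:R)). Qed.

End Graph.

(** * Tree diagrams and moments of the cluster size *)

Section Diagrams.
Variables (R : realType) (T : finType) (e : rel T).
Variable p : R.
Hypothesis p01 : 0 <= p <= 1.
Implicit Types (f : {set {set T}} -> R) (o u v x y z : T).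

Local Notation E := (bond_mean e p).
Local Notation tau := (tau e p).

Lemma mean3_prod f1 f2 f3 :
  E (fun w1 => E (fun w2 => E (fun w3 => f1 w1 * f2 w2 * f3 w3))) = E f1 * E f2 * E f3.
Proof.
rewrite -!bmeanZr; apply: eq_bmean => w1; rewrite -mulrA -[f1 w1 * _]mulrC -bmeanZr -bmeanZr.
apply: eq_bmean => w2; rewrite -bmeanZ -bmeanZr; apply: eq_bmean => w3; ring.
Qed.

Lemma mean3D (f g : {set {set T}} -> {set {set T}} -> {set {set T}} -> R) :
  E (fun w1 => E (fun w2 => E (fun w3 => f w1 w2 w3 + g w1 w2 w3))) =
  E (fun w1 => E (fun w2 => E (fun w3 => f w1 w2 w3))) +
  E (fun w1 => E (fun w2 => E (fun w3 => g w1 w2 w3))).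
Proof.
by rewrite -bmeanD; apply: eq_bmean => w1; rewrite -bmeanD; apply: eq_bmean => w2; rewrite -bmeanD.
Qed.

Lemma mean3_sum (I : finType) (F : I -> {set {set T}} -> {set {set T}} -> {set {set T}} -> R) :
  E (fun w1 => E (fun w2 => E (fun w3 => \sum_i F i w1 w2 w3))) =
  \sum_i E (fun w1 => E (fun w2 => E (fun w3 => F i w1 w2 w3))).
Proof.
rewrite -bmean_sum; apply: eq_bmean => w1; rewrite -bmean_sum; apply: eq_bmean => w2.
by rewrite -bmean_sum.
Qed.

Lemma nat_of_bool_le (b c : bool) : (b -> c) -> b%:R <= c%:R :> R.
Proof. by case: b c => [] [] // /(_ isT). Qed.

Lemma mem_cluster_mono (w w' : {set {set T}}) x o :
  w \subset w' -> (x \in cluster w o)%:R <= (x \in cluster w' o)%:R :> R.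
Proof. by move=> ww'; apply: nat_of_bool_le; apply/subsetP/cluster_mono. Qed.

Lemma card_cluster_mono (w w' : {set {set T}}) o :
  w \subset w' -> (#|cluster w o| <= #|cluster w' o|)%N.
Proof. by move=> ww'; apply/subset_leq_card/cluster_mono. Qed.

(** The Aizenman - Newman tree-graph inequality with a monotone weight: the three
    legs of the tripod cover the cluster, so the sum of their sizes dominates its
    size. *)
Lemma tree_graph_le (h : nat -> R) o x y :
  {homo h : m n / (m <= n)%N >-> m <= n} -> (forall n, 0 <= h n) ->
  E (fun w => (x \in cluster w o)%:R * (y \in cluster w o)%:R * h #|cluster w o|) <=
  \sum_z E (fun w1 => E (fun w2 => E (fun w3 =>
    (z \in cluster w1 o)%:R * (x \in cluster w2 z)%:R * (y \in cluster w3 z)%:R *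
    h (#|cluster w1 o| + #|cluster w2 z| + #|cluster w3 z|)%N))).
Proof.
move=> hmono h0; rewrite -mean3_sum; apply: bmean_BK => //.
  move=> S1 S1' S2 S2' S3 S3' s1 s2 s3; apply: ler_sum => z _.
  apply: ler_pM; rewrite ?mulr_ge0 //; last first.
    by apply: hmono; rewrite !leq_add ?card_cluster_mono.
  by rewrite !ler_pM ?mulr_ge0 ?mem_cluster_mono.
move=> w; have [xw|xw] := boolP (x \in cluster w o); last first.
  exists set0, set0, set0; split; first by split; rewrite ?setI0 //; split; rewrite sub0set.
  by rewrite !mul0r; apply: sumr_ge0 => z _; rewrite !mulr_ge0.
have [yw|yw] := boolP (y \in cluster w o); last first.
  exists set0, set0, set0; split; first by split; rewrite ?setI0 //; split; rewrite sub0set.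
  by rewrite mulr0 !mul0r; apply: sumr_ge0 => z _; rewrite !mulr_ge0.
have [z [S1 [S2 [S3 [spl [zS1 xS2 yS3] cov]]]]] := median xw yw.
exists S1, S2, S3; split=> //; rewrite (bigD1 z) //= zS1 xS2 yS3 !mul1r.
rewrite -[leLHS]addr0; apply: lerD; last by apply: sumr_ge0 => ? _; rewrite !mulr_ge0.
apply: hmono; apply: leq_trans (subset_leq_card cov) _.
by apply: leq_trans (leq_card_setU _ _) _; rewrite leq_add2r leq_card_setU.
Qed.

Lemma three_point_le o x y :
  E (fun w => (x \in cluster w o)%:R * (y \in cluster w o)%:R) <=
  \sum_z tau o z * tau z x * tau z y.
Proof.
have := @tree_graph_le (fun=> 1) o x y (fun _ _ _ => lexx _) (fun _ => ler01).
rewrite (eq_bmean _ _ (fun w => mulr1 _)) => /le_trans; apply.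
apply: ler_sum => z _; rewrite !tauE -mean3_prod le_eqVlt; apply/orP; left; apply/eqP.
by apply: eq_bmean => w1; apply: eq_bmean => w2; apply: eq_bmean => w3; rewrite mulr1.
Qed.

Lemma weighted_square_le (h : nat -> R) o :
  {homo h : m n / (m <= n)%N >-> m <= n} -> (forall n, 0 <= h n) ->
  E (fun w => #|cluster w o|%:R ^+ 2 * h #|cluster w o|) <=
  \sum_z E (fun w1 => E (fun w2 => E (fun w3 =>
    (z \in cluster w1 o)%:R * #|cluster w2 z|%:R * #|cluster w3 z|%:R *
    h (#|cluster w1 o| + #|cluster w2 z| + #|cluster w3 z|)%N))).
Proof.
move=> hmono h0.
have -> : E (fun w => #|cluster w o|%:R ^+ 2 * h #|cluster w o|) =
  \sum_x \sum_y E (fun w => (x \in cluster w o)%:R * (y \in cluster w o)%:R * h #|cluster w o|).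
  rewrite pair_bigA -bmean_sum; apply: eq_bmean => w; rewrite -mulr_suml.
  rewrite -(pair_bigA _ (fun x y => (x \in cluster w o)%:R * (y \in cluster w o)%:R)) /=.
  by rewrite expr2 card_sumR big_distrlr.
apply: (@le_trans _ _ (\sum_x \sum_y \sum_z E (fun w1 => E (fun w2 => E (fun w3 =>
    (z \in cluster w1 o)%:R * (x \in cluster w2 z)%:R * (y \in cluster w3 z)%:R *
    h (#|cluster w1 o| + #|cluster w2 z| + #|cluster w3 z|)%N))))).
  by apply: ler_sum => x _; apply: ler_sum => y _; apply: tree_graph_le.
rewrite le_eqVlt; apply/orP; left; apply/eqP.
rewrite (eq_bigr _ (fun x _ => exchange_big _ _ _ _ _ _)) /= exchange_big /=.
apply: eq_bigr => z _; rewrite pair_bigA -mean3_sum.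
apply: eq_bmean => w1; apply: eq_bmean => w2; apply: eq_bmean => w3.
rewrite -mulr_suml; congr (_ * _).
rewrite -(pair_bigA _ (fun x y => (z \in cluster w1 o)%:R * (x \in cluster w2 z)%:R *
   (y \in cluster w3 z)%:R)) /=.
rewrite -mulrA (card_sumR _ (cluster w2 z)) (card_sumR _ (cluster w3 z)) big_distrlr.
rewrite mulr_sumr; apply: eq_bigr => x _; rewrite mulr_sumr.
by apply: eq_bigr => y _; rewrite mulrA.
Qed.

Hypothesis simp : simple_graph e.
Hypothesis trans : transitive_graph e.

Local Notation chi := (chi e p).

Lemma chiE o : chi o = E (fun w => #|cluster w o|%:R).
Proof. by rewrite /Defs.chi ExpectE. Qed.

Lemma sum_mean_mem (h : nat -> R) o :
  \sum_z E (fun w => (z \in cluster w o)%:R * h #|cluster w o|) =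
  E (fun w => #|cluster w o|%:R * h #|cluster w o|).
Proof.
rewrite -bmean_sum; apply: eq_bmean => w.
by rewrite -mulr_suml -card_sumR.
Qed.

Lemma moment2_le o : E (fun w => #|cluster w o|%:R ^+ 2) <= chi o ^+ 3.
Proof.
have := @weighted_square_le (fun=> 1) o (fun _ _ _ => lexx _) (fun _ => ler01).
rewrite (eq_bmean _ _ (fun w => mulr1 _)) => /le_trans; apply.
rewrite le_eqVlt; apply/orP; left; apply/eqP.
rewrite exprSr expr2 -[X in _ = X * _ * _]/(chi o) {1}chi_tau !mulr_suml.
apply: eq_bigr => z _; rewrite -!(chi_trans simp trans p z) !chiE tauE -mean3_prod.
by apply: eq_bmean => w1; apply: eq_bmean => w2; apply: eq_bmean => w3; rewrite mulr1.
Qed.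

Lemma chi_ge1 o : 1 <= chi o.
Proof.
rewrite chiE -[leLHS](bmean_cst p (enum (bonds e)) 1); apply: bmean_le => // w.
by rewrite ler1n card_gt0; apply/set0Pn; exists o; apply: mem_cluster.
Qed.

Lemma moment3_le o : E (fun w => #|cluster w o|%:R ^+ 3) <= 3 * chi o ^+ 5.
Proof.
have homoN : {homo (fun n => n%:R : R) : m n / (m <= n)%N >-> m <= n}.
  by move=> m n; rewrite ler_nat.
have := @weighted_square_le (fun n => n%:R) o homoN (fun n => ler0n _ n).
rewrite (eq_bmean _ _ (fun w => esym (exprSr _ _))) => /le_trans; apply.
have m2 := moment2_le o; have c1 := chi_ge1 o.
apply: (@le_trans _ _ (3 * (chi o ^+ 2 * E (fun w => #|cluster w o|%:R ^+ 2)))); last first.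
  by rewrite ler_pM2l // (exprD _ 2 3) ler_wpM2l // exprn_ge0 // (le_trans ler01).
rewrite le_eqVlt; apply/orP; left; apply/eqP.
pose m2' := E (fun w => #|cluster w o|%:R ^+ 2).
transitivity (\sum_z (E (fun w => (z \in cluster w o)%:R * #|cluster w o|%:R) * chi o * chi o
   + tau o z * m2' * chi o + tau o z * chi o * m2')).
  apply: eq_bigr => z _; rewrite -!(chi_trans simp trans p z) !chiE tauE.
  rewrite /m2' -(mean_card_cluster simp trans p (fun n => n%:R ^+ 2) z o) -!mean3_prod -!mean3D.
  by apply: eq_bmean => w1; apply: eq_bmean => w2; apply: eq_bmean => w3; rewrite !natrD; ring.
rewrite !big_split /= -!mulr_suml -chi_tau.
rewrite (sum_mean_mem (fun n => n%:R)).
have -> : E (fun w => #|cluster w o|%:R * #|cluster w o|%:R) = m2'.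
  by apply: eq_bmean => w; rewrite expr2.
rewrite -/m2'; ring.
Qed.

(** The exponential weight factorizes over the three legs; the left-hand side is
    the derivative in [t] of the mean whose cube appears on the right. *)
Lemma exp_moment_step (t : R) o : 0 <= t ->
  E (fun w => #|cluster w o|%:R ^+ 2 * expR (t * #|cluster w o|%:R)) <=
  (E (fun w => #|cluster w o|%:R * expR (t * #|cluster w o|%:R))) ^+ 3.
Proof.
move=> t0.
have homoN : {homo (fun n => expR (t * n%:R) : R) : m n / (m <= n)%N >-> m <= n}.
  by move=> m n mn; rewrite ler_expR ler_wpM2l // ler_nat.
have := @weighted_square_le (fun n => expR (t * n%:R)) o homoN (fun n => expR_ge0 _).
move=> /le_trans; apply; rewrite le_eqVlt; apply/orP; left; apply/eqP.
rewrite exprSr expr2 -{1}(sum_mean_mem (fun n => expR (t * n%:R))) !mulr_suml.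
apply: eq_bigr => z _.
rewrite -!(mean_card_cluster simp trans p (fun n => n%:R * expR (t * n%:R)) z o) -mean3_prod.
apply: eq_bmean => w1; apply: eq_bmean => w2; apply: eq_bmean => w3.
by rewrite !natrD !mulrDr !expRD; ring.
Qed.

End Diagrams.

(** * Adding, removing and exploring bonds *)

Section ClusterSurgery.
Variable T : finType.
Implicit Types (w : {set {set T}}) (A : {set T}) (o u v x : T).

Lemma cluster_addb w u v o :
  cluster ([set u; v] |: w) o =
  cluster w o :|: (if u \in cluster w o then cluster w v else set0)
              :|: (if v \in cluster w o then cluster w u else set0).
Proof.
have sub : w \subset [set u; v] |: w by apply: subsetUr.
apply/eqP; rewrite eqEsubset; apply/andP; split; last first.
  rewrite !subUset cluster_mono //=; apply/andP; split.
    case: ifP => [uo|_]; last exact: sub0set.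
    have vo : v \in cluster ([set u; v] |: w) o.
      apply: (@cluster_step _ _ _ u); last exact: setU11.
      by apply: (subsetP (cluster_mono _ sub)) uo.
    by rewrite -(cluster_eq vo) cluster_mono.
  case: ifP => [vo|_]; last exact: sub0set.
  have uo : u \in cluster ([set u; v] |: w) o.
    apply: (@cluster_step _ _ _ v); last by rewrite [[set v; u]]setUC setU11.
    by apply: (subsetP (cluster_mono _ sub)) vo.
  by rewrite -(cluster_eq uo) cluster_mono.
apply: cluster_closed => [|a c]; first by rewrite !in_setU mem_cluster.
set A := cluster w o :|: _ :|: _ => aA.
have wcl d : [set a; d] \in w -> d \in A.
  move=> ad; move: aA; rewrite /A !in_setU -orbA => /or3P[aa|aa|aa].
  - by rewrite (cluster_step aa ad).
  - move: aa; case: ifP => [_ aa|_]; last by rewrite inE.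
    by rewrite (cluster_step aa ad) orbT.
  - move: aa; case: ifP => [_ aa|_]; last by rewrite inE.
    by rewrite (cluster_step aa ad) !orbT.
have uvA : (u \in A) = (v \in A).
  rewrite /A !in_setU; case: ifP => uo; case: ifP => vo;
    rewrite ?uo ?vo ?mem_cluster ?orbT ?in_set0 //.
apply: contra => //; rewrite in_setU1 => /orP[/eqP eqac|/wcl //].
have : a \in [set u; v] by rewrite -eqac !inE eqxx.
have : c \in [set u; v] by rewrite -eqac !inE eqxx orbT.
rewrite !in_set2 => /orP[] /eqP cE /orP[] /eqP aE; rewrite ?cE ?aE -?uvA //.
- by rewrite -aE.
- by rewrite uvA -aE.
- by rewrite -aE.
- by rewrite uvA -aE.
Qed.

Lemma cluster_addb_id w u v o :
  v \in cluster w u -> cluster ([set u; v] |: w) o = cluster w o.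
Proof.
move=> vu; rewrite cluster_addb.
have uv : (u \in cluster w o) = (v \in cluster w o).
  by rewrite [in LHS]cluster_sym [in RHS]cluster_sym (cluster_eq vu).
rewrite (cluster_eq vu) uv; case: ifP => [vo|_]; last by rewrite !setU0.
by rewrite (cluster_eq (_ : u \in cluster w o)) ?setUid // uv.
Qed.

(** The sum of the cluster sizes is the sum of the squared sizes of the connected
    components; merging components of sizes [m] and [n] increases it by [2mn]. *)
Lemma sum_cluster_addb w u v :
  (\sum_x #|cluster ([set u; v] |: w) x| =
   \sum_x #|cluster w x| +
   (v \notin cluster w u) * (2 * (#|cluster w u| * #|cluster w v|)))%N.
Proof.
have [vu|vu] /= := boolP (v \in cluster w u).
  by rewrite mul0n addn0; apply: eq_bigr => x _; rewrite cluster_addb_id.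
have disj : cluster w u :&: cluster w v = set0.
  apply/eqP; rewrite -subset0; apply/subsetP => x; rewrite !inE; move: vu.
  rewrite !inE => /negP vu /andP[ux vx]; case: vu; apply: connect_trans ux _.
  by rewrite occupied_connect_sym.
rewrite mul1n mul2n -addnn -{2}[(#|cluster w u| * _)%N]mulnC.
have sumC u' n : (#|cluster w u'| * n = \sum_x (x \in cluster w u') * n)%N.
  by rewrite -sum_nat_const big_mkcond; apply: eq_bigr => x _; case: ifP; rewrite ?mul1n.
rewrite !sumC -!big_split; apply: eq_bigr => x _ /=.
rewrite cluster_addb (cluster_sym _ u x) (cluster_sym _ v x) /=.
case: ifP => ux; case: ifP => vx.
- by have := in_set0 x; rewrite -disj inE ux vx.
- by rewrite setU0 (cluster_eq ux) cardsU disj cards0 subn0 mul1n mul0n addn0.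
- by rewrite setU0 (cluster_eq vx) cardsU setIC disj cards0 subn0 mul1n mul0n add0n.
- by rewrite !setU0 !mul0n !addn0.
Qed.

(** The exclusion of the empty set matters because configurations are arbitrary sets
    of sets here: it would be inside every cluster. *)
Definition bonds_inside w o := [set c in w | (c \subset cluster w o) && (c != set0)].

Lemma cluster_bonds_inside w o : cluster (bonds_inside w o) o = cluster w o.
Proof.
have sub : bonds_inside w o \subset w by apply/subsetP => c; rewrite inE => /andP[].
apply/eqP; rewrite eqEsubset cluster_mono //=.
apply: cluster_closed => [|a b ao]; first exact: mem_cluster.
apply: contra => ab; apply: (cluster_step ao).
have ao' := subsetP (cluster_mono o sub) _ ao.
rewrite inE ab subUset !sub1set ao' (cluster_step ao' ab) /=.
by apply/set0Pn; exists a; rewrite !inE eqxx.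
Qed.

Lemma bonds_inside_disjoint w u v :
  v \notin cluster w u -> bonds_inside w u :&: bonds_inside w v = set0.
Proof.
move=> vu; apply/eqP; rewrite -subset0; apply/subsetP => c; rewrite !inE.
move=> /andP[/and3P[_ /subsetP cu /set0Pn[x xc]] /and3P[_ /subsetP cv _]].
move: vu; rewrite -(cluster_eq (cu x xc)) (_ : v \in cluster w x) //.
by rewrite cluster_sym cv.
Qed.

Definition touching A : {set {set T}} := [set c : {set T} | ~~ [disjoint c & A]].

(** The exploration of a cluster only reads the bonds that touch it. *)
Lemma cluster_touching w A o :
  (cluster w o == A) = (cluster (w :&: touching A) o == A).
Proof.
have tch a b : a \in A -> [set a; b] \in touching A.
  by move=> aA; rewrite inE -setI_eq0; apply/set0Pn; exists a; rewrite !inE eqxx.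
apply/eqP/eqP => eqA.
  apply/eqP; rewrite eqEsubset; apply/andP; split.
    by rewrite -{2}eqA cluster_mono // subsetIl.
  rewrite -{1}eqA; apply: cluster_closed => [|a b ao]; first exact: mem_cluster.
  apply: contra => ab; apply: (cluster_step ao).
  rewrite inE ab tch // -eqA.
  by apply: (subsetP (cluster_mono o (subsetIl w (touching A)))).
apply/eqP; rewrite eqEsubset; apply/andP; split; last first.
  by rewrite -{1}eqA cluster_mono // subsetIl.
apply: cluster_closed => [|a b aA]; first by rewrite -eqA mem_cluster.
apply: contra => ab; move: (aA); rewrite -{1}eqA => aA'; rewrite -eqA.
by apply: (cluster_step aA'); rewrite inE ab tch.
Qed.

Lemma bonds_off_touching A w : bonds_off A (w :\: touching A) = bonds_off A w.
Proof. by apply/setP => c; rewrite !inE negbK andbAC andbb andbC. Qed.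

(** The size of the cluster of [v] after the deletion of the vertices of [A]. *)
Definition card_off A w v : nat := if v \in A then 0%N else #|cluster (bonds_off A w) v|.

End ClusterSurgery.

(** * Pivotal bonds *)

Section Pivotal.
Variables (R : realType) (T : finType) (e : rel T).
Variable p : R.
Hypothesis p01 : 0 <= p <= 1.
Implicit Types (f : {set {set T}} -> R) (o u v x y z : T) (b : {set T}).

Local Notation E := (bond_mean e p).
Local Notation tau := (tau e p).

(** Distinct clusters use disjoint sets of bonds. The map [phi] is the identity or
    the removal of one bond. *)
Lemma pair_cluster_le (phi : {set {set T}} -> {set {set T}}) (h1 h2 : nat -> R) u v :
  (forall w, phi w \subset w) ->
  {homo h1 : m n / (m <= n)%N >-> m <= n} -> (forall n, 0 <= h1 n) ->
  {homo h2 : m n / (m <= n)%N >-> m <= n} -> (forall n, 0 <= h2 n) ->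
  E (fun w => (v \notin cluster (phi w) u)%:R *
              (h1 #|cluster (phi w) u| * h2 #|cluster (phi w) v|)) <=
  E (fun w => h1 #|cluster w u|) * E (fun w => h2 #|cluster w v|).
Proof.
move=> phiw h1m h10 h2m h20.
apply: (@le_trans _ _ (E (fun w1 => E (fun w2 => E (fun w3 =>
    h1 #|cluster w1 u| * h2 #|cluster w2 v| * 1))))); last first.
  by rewrite (mean3_prod e p (fun w => h1 #|cluster w u|)
    (fun w => h2 #|cluster w v|) (fun=> 1)) bmean_cst mulr1.
apply: bmean_BK => // [S1 S1' S2 S2' S3 S3' s1 s2 _|w].
  rewrite !mulr1; apply: ler_pM => //; first by apply/h1m/card_cluster_mono.
  by apply/h2m/card_cluster_mono.
have [vu|vu] := boolP (v \in cluster (phi w) u).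
  exists set0, set0, set0; split; first by split; rewrite ?setI0 //; split; rewrite sub0set.
  by rewrite mul0r !mulr_ge0.
exists (bonds_inside (phi w) u), (bonds_inside (phi w) v), set0; split; last first.
  by rewrite !cluster_bonds_inside mul1r mulr1.
split; rewrite ?setI0 ?bonds_inside_disjoint //; split; rewrite ?sub0set //.
  by apply: subset_trans (phiw w); apply/subsetP => c; rewrite inE => /andP[].
by apply: subset_trans (phiw w); apply/subsetP => c; rewrite inE => /andP[].
Qed.

Hypothesis simp : simple_graph e.
Hypothesis trans : transitive_graph e.
Local Notation chi := (chi e p).

(** When [b] joins [u] to [v], this is the mean number of pairs of vertices, one on
    each side, for which [b] is pivotal. *)
Definition pivotal_pair b u v : R :=
  E (fun w => (v \notin cluster (w :\ b) u)%:R *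
              (#|cluster (w :\ b) u|%:R * #|cluster (w :\ b) v|%:R)).

Lemma pivotal_pair_le b u v o : pivotal_pair b u v <= chi o ^+ 2.
Proof.
have homoN : {homo (fun n => n%:R : R) : m n / (m <= n)%N >-> m <= n}.
  by move=> m n; rewrite ler_nat.
apply: (le_trans (pair_cluster_le (phi := fun w => w :\ b) u v _ homoN _ homoN _)) => //.
  by move=> w; apply: subsetDl.
by rewrite -!chiE !(chi_trans simp trans p _ o) expr2.
Qed.

Lemma through_set_le (A : {set T}) v x :
  E (fun w => (x \in cluster w v)%:R - ((v \notin A) && (x \in cluster (bonds_off A w) v))%:R) <=
  \sum_(a in A) tau v a * tau a x.
Proof.
apply: (@le_trans _ _ (\sum_a E (fun w1 => E (fun w2 => E (fun w3 =>
    (a \in A)%:R * (a \in cluster w1 v)%:R * (x \in cluster w2 a)%:R * 1))))); last first.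
  rewrite [leRHS]big_mkcond; apply: ler_sum => a _.
  rewrite (mean3_prod e p (fun w => (a \in A)%:R * (a \in cluster w v)%:R)
    (fun w => (x \in cluster w a)%:R) (fun=> 1)).
  rewrite bmeanZ bmean_cst mulr1 !tauE.
  by case: (a \in A); rewrite ?mul1r ?mul0r.
rewrite -mean3_sum; apply: bmean_BK => // [S1 S1' S2 S2' S3 S3' s1 s2 _|w].
  by apply: ler_sum => a _; rewrite !mulr1 !ler_pM ?mulr_ge0 ?mem_cluster_mono.
have [xw|xw] := boolP (x \in cluster w v); last first.
  exists set0, set0, set0; split; first by split; rewrite ?setI0 //; split; rewrite sub0set.
  apply: (@le_trans _ _ 0); first by rewrite sub0r oppr_le0.
  by apply: sumr_ge0 => a _; rewrite !mulr_ge0.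
have [/andP[vA xoff]|] := boolP ((v \notin A) && (x \in cluster (bonds_off A w) v)).
  exists set0, set0, set0; split; first by split; rewrite ?setI0 //; split; rewrite sub0set.
  by rewrite subrr; apply: sumr_ge0 => a _; rewrite !mulr_ge0.
rewrite negb_and negbK => /orP/(through_set xw)[a [S1 [S2 [spl aA c1 c2]]]].
exists S1, S2, set0; split=> //; rewrite (bigD1 a) //= aA c1 c2 subr0 !mulr1.
by rewrite lerDl; apply: sumr_ge0 => ? _; rewrite !mulr_ge0.
Qed.

(** What the removal of [A] takes away from the cluster of [v] was reached through
    some vertex of [A]. *)
Lemma card_off_ge (A : {set T}) v o :
  chi o * (1 - \sum_(a in A) tau v a) <= E (fun w => (card_off A w v)%:R).
Proof.
rewrite mulrBr mulr1 lerBlDr -(chi_trans simp trans p v) {1}chiE -lerBlDl -bmeanB.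
have -> : E (fun w => #|cluster w v|%:R - (card_off A w v)%:R) = \sum_x
  E (fun w => (x \in cluster w v)%:R - ((v \notin A) && (x \in cluster (bonds_off A w) v))%:R).
  rewrite -bmean_sum; apply: eq_bmean => w; rewrite sumrB -card_sumR; congr (_ - _).
  rewrite /card_off; case: (v \in A); first by rewrite big1.
  by rewrite card_sumR.
apply: le_trans (ler_sum _ (fun x _ => through_set_le A v x)) _.
rewrite exchange_big mulr_sumr /=; apply: ler_sum => a _.
by rewrite -mulr_sumr -chi_tau mulrC (chi_trans simp trans p a v).
Qed.

(** Given that the cluster of [u] off [b] equals [A], the bonds not touching [A] are
    still independent, so the cluster of [v] may be computed in a fresh configuration
    [w'] from which [A] is removed. *)
Lemma pivotal_pair_explore b u v : u \in b ->
  E (fun w => #|cluster (w :\ b) u|%:R *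
              E (fun w' => (card_off (cluster (w :\ b) u) w' v)%:R)) <= pivotal_pair b u v.
Proof.
move=> ub.
have decomp (G : {set T} -> {set {set T}} -> R) :
  E (fun w => G (cluster (w :\ b) u) w) =
  \sum_A E (fun w => (cluster (w :\ b) u == A)%:R * G A w).
  rewrite -bmean_sum; apply: eq_bmean => w; rewrite (bigD1 (cluster (w :\ b) u)) //= eqxx mul1r.
  by rewrite big1 ?addr0 // => A; rewrite eq_sym => /negbTE ->; rewrite mul0r.
rewrite (decomp (fun A w => #|A|%:R * E (fun w' => (card_off A w' v)%:R))).
have -> : \sum_A E (fun w => (cluster (w :\ b) u == A)%:R *
            (#|A|%:R * E (fun w' => (card_off A w' v)%:R))) =
          \sum_A E (fun w => (cluster (w :\ b) u == A)%:R *
            (#|A|%:R * (card_off A w v)%:R)).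
  apply: eq_bigr => A _; rewrite bmeanZr -bmeanZ.
  rewrite -(@bmean_indep _ _ _ _ (touching A)) // => w.
    rewrite cluster_touching; congr (_ == _)%:R; congr (cluster _ _).
    by apply/setP => c; rewrite !inE andbA.
  by rewrite /card_off -(bonds_off_touching A w).
rewrite -(decomp (fun A w => #|A|%:R * (card_off A w v)%:R)).
apply: bmean_le => // w; rewrite /card_off; case: ifP => vA; first by rewrite mulr0 mulr_ge0.
rewrite mul1r ler_wpM2l // ler_nat; apply: subset_leq_card.
apply: cluster_mono; apply/subsetP => c; rewrite !inE => /andP[-> dis]; rewrite andbT.
apply: contraTneq dis => ->; rewrite -setI_eq0; apply/set0Pn; exists u.
by rewrite !inE ub /=.
Qed.

Lemma tau_ge0 x y : 0 <= tau x y.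
Proof. by rewrite tauE; apply: bmean_ge0. Qed.

(** If restoring the bond changes the cluster of [u], then [v] joins it, and the term
    [tau v v = 1] lowers the second factor by at least [1]. That factor becomes
    nonpositive, so the growth of the cluster only lowers the product. This is why
    the lower bound on the derivative has the constant [1 - a0], with no correction
    for the state of the bond. *)
Lemma restore_bond_le w u v :
  #|cluster w u|%:R * (1 - \sum_(a in cluster w u) tau v a) <=
  #|cluster (w :\ [set u; v]) u|%:R *
    (1 - \sum_(a in cluster (w :\ [set u; v]) u) tau v a).
Proof.
set b := [set u; v]; set C := cluster w u; set Cb := cluster (w :\ b) u.
have sub : Cb \subset C by apply: cluster_mono; apply: subsetDl.
have [->//|neqC] := eqVneq C Cb.
have bw : b \in w.
  apply: contraNT neqC => bw; rewrite /C /Cb (_ : w :\ b = w) //.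
  by apply/setDidPl; rewrite disjoint_sym disjoints1.
have vCb : v \notin Cb.
  apply: contraNN neqC => vCb; apply/eqP; rewrite /C -(setD1K bw).
  exact: cluster_addb_id.
have vC : v \in C by apply: (@cluster_step _ _ _ u); rewrite ?mem_cluster.
have S1 : 1 + \sum_(a in Cb) tau v a <= \sum_(a in C) tau v a.
  rewrite (bigD1 v vC) /= tau_refl lerD2l big_mkcond [leRHS]big_mkcond /=.
  apply: ler_sum => a _; case: ifP => [aCb|_].
    have aC : a \in C by apply: (subsetP sub).
    rewrite ifT //; apply/andP; split=> //.
    by apply: contraNneq vCb => <-.
  by case: ifP => // _; apply: tau_ge0.
have S0 : 0 <= \sum_(a in Cb) tau v a by apply: sumr_ge0 => *; apply: tau_ge0.
have cle : #|Cb|%:R <= #|C|%:R :> R by rewrite ler_nat subset_leq_card.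
have c0 : 0 <= #|Cb|%:R :> R by [].
by nra.
Qed.

Lemma pivotal_pair_ge u v o :
  chi o ^+ 2 * (1 - nabla e p u v) <= pivotal_pair [set u; v] u v.
Proof.
have ub : u \in [set u; v] by rewrite !inE eqxx.
apply: le_trans (pivotal_pair_explore v ub).
have chi0 : 0 <= chi o by rewrite (le_trans ler01) // chi_ge1.
apply: (@le_trans _ _ (E (fun w => chi o * (#|cluster w u|%:R *
    (1 - \sum_(a in cluster w u) tau v a))))); last first.
  apply: bmean_le => // w; apply: (@le_trans _ _ (chi o * (#|cluster (w :\ [set u; v]) u|%:R *
    (1 - \sum_(a in cluster (w :\ [set u; v]) u) tau v a)))).
    by rewrite ler_wpM2l // restore_bond_le.
  by rewrite mulrCA ler_wpM2l // card_off_ge.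
rewrite bmeanZ expr2 -mulrA ler_wpM2l //.
have -> : E (fun w => #|cluster w u|%:R * (1 - \sum_(a in cluster w u) tau v a)) =
  chi u - \sum_a tau v a * \sum_y E (fun w => (a \in cluster w u)%:R * (y \in cluster w u)%:R).
  under [in RHS]eq_bigr => a _ do rewrite -bmean_sum -bmeanZ.
  rewrite chiE -bmean_sum -bmeanB; apply: eq_bmean => w.
  rewrite mulrBr mulr1; congr (_ - _); rewrite big_mkcond mulr_sumr.
  apply: eq_bigr => a _; rewrite -mulr_sumr -card_sumR.
  by case: (a \in _); rewrite ?mul1r ?mul0r ?mulr0 // mulrC.
rewrite mulrBr mulr1 (chi_trans simp trans p u o) lerD2l lerN2 /nabla mulr_sumr.
under [leRHS]eq_bigr => z _ do rewrite mulr_sumr.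
rewrite [leRHS]exchange_big /=; apply: ler_sum => a _.
apply: (@le_trans _ _ (tau v a * \sum_y \sum_z tau u z * tau z a * tau z y)).
  rewrite ler_wpM2l ?tau_ge0 //; apply: ler_sum => y _; exact: three_point_le.
rewrite exchange_big mulr_sumr; apply: ler_sum => z _.
rewrite -mulr_sumr -chi_tau (chi_trans simp trans p z o) (tau_sym e p v a).
by rewrite le_eqVlt; apply/orP; left; apply/eqP; ring.
Qed.

End Pivotal.

(** * Differential inequalities for the susceptibility *)

Section Susceptibility.
Variables (R : realType) (T : finType) (e : rel T).
Hypothesis simp : simple_graph e.
Hypothesis trans : transitive_graph e.
Variable Omega : nat.
Hypothesis reg : forall x, degree e x = Omega.
Implicit Types (p : R) (o x u v : T).

Definition dchi p o : R := \sum_(b <- enum (bonds e))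
  bond_mean e p (fun w => #|cluster (b |: w) o|%:R - #|cluster (w :\ b) o|%:R).

Lemma chi_derive p o : is_derive p (1 : R) (fun q => chi e q o) (dchi p o).
Proof.
have -> : (fun q : R => chi e q o) = (fun q =>
    bmean q (enum (bonds e)) (fun w => #|cluster w o|%:R)).
  by apply/boolp.funext => q; rewrite chiE.
apply: (bmean_derive p (fun w => #|cluster w o|%:R)); exact: enum_uniq.
Qed.

(** Clusters of all vertices have the same mean size for every [p], hence the same
    derivative. *)
Lemma dchi_trans p x o : dchi p x = dchi p o.
Proof.
have Dx := chi_derive p x; have Do := chi_derive p o.
have eqc : (fun q : R => chi e q x) = (fun q => chi e q o).
  by apply/boolp.funext => q; apply: chi_trans.
by rewrite -(@derive_val _ _ _ _ _ _ _ Dx) eqc derive_val.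
Qed.

(** Summing over the vertex replaces the cluster of [o] by the sum of all the
    cluster sizes, whose variation at a bond is symmetric in its two ends. *)
Lemma dchi_flip_sum p o : #|T|%:R * dchi p o = \sum_(b <- enum (bonds e))
  bond_mean e p (fun w => (\sum_x #|cluster (b |: w) x|)%:R - (\sum_x #|cluster (w :\ b) x|)%:R).
Proof.
rewrite mulr_natl -sumr_const -(eq_bigr _ (fun x _ => dchi_trans p x o)).
rewrite exchange_big /=; apply: eq_bigr => b _; rewrite -bmean_sum; apply: eq_bmean => w.
by rewrite sumrB !natr_sum.
Qed.

Lemma flip_sum_pivotal p u v :
  bond_mean e p (fun w => (\sum_x #|cluster ([set u; v] |: w) x|)%:R -
                       (\sum_x #|cluster (w :\ [set u; v]) x|)%:R) =
  2 * pivotal_pair e p [set u; v] u v.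
Proof.
rewrite -bmeanZ; apply: eq_bmean => w; set b := [set u; v].
have -> : b |: w = b |: (w :\ b).
  by apply/setP => c; rewrite !inE; case: (c == b).
rewrite sum_cluster_addb natrD addrAC subrr add0r !natrM.
by case: (v \in _); rewrite /= ?mul0r ?mulr0 // !mul1r.
Qed.

Lemma natT_gt0 (o : T) : 0 < #|T|%:R :> R.
Proof. by rewrite ltr0n; apply/card_gt0P; exists o. Qed.

Lemma sum_bonds_cst (c : R) : \sum_(b <- enum (bonds e)) 2 * c = #|T|%:R * (Omega%:R * c).
Proof.
rewrite big_enum /= sumr_const -[LHS]mulr_natl !mulrA -!natrM card_bonds //.
by rewrite (eq_bigr _ (fun x _ => reg x)) sum_nat_const.
Qed.

Lemma dchi_le p o : 0 <= p <= 1 -> dchi p o <= Omega%:R * chi e p o ^+ 2.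
Proof.
move=> p01; rewrite -(ler_pM2l (natT_gt0 o)) dchi_flip_sum -sum_bonds_cst.
rewrite big_seq [leRHS]big_seq; apply: ler_sum => b; rewrite mem_enum.
move=> /(bondsP simp)[u [v [_ _ ->]]]; rewrite flip_sum_pivotal ler_pM2l //.
exact: pivotal_pair_le.
Qed.

Lemma dchi_ge p a0 o : 0 <= p <= 1 -> triangle_condition e p a0 ->
  (1 - a0) * Omega%:R * chi e p o ^+ 2 <= dchi p o.
Proof.
move=> p01 tri; rewrite -(ler_pM2l (natT_gt0 o)) dchi_flip_sum.
rewrite -mulrA mulrCA -sum_bonds_cst mulr_sumr.
rewrite big_seq [leRHS]big_seq; apply: ler_sum => b; rewrite mem_enum.
move=> /(bondsP simp)[u [v [_ nuv ->]]]; rewrite flip_sum_pivotal mulrCA ler_pM2l //.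
apply: le_trans (pivotal_pair_ge p01 simp trans u v o); rewrite mulrC.
rewrite ler_wpM2l ?exprn_ge0 ?(le_trans ler01 (chi_ge1 _ _ _)) //.
by have := tri u v; rewrite (negbTE nuv) add0r => ?; rewrite lerD2l lerN2.
Qed.

End Susceptibility.

(** * Integration of the differential inequalities *)

Section Calculus.
Variable R : realType.
Implicit Types (f df : R -> R) (a b c lo hi : R).

Lemma increment_bounds f df a b lo hi : a <= b ->
  (forall x, a <= x <= b -> is_derive x (1 : R) f (df x)) ->
  (forall x, a <= x <= b -> lo <= df x <= hi) ->
  lo * (b - a) <= f b - f a <= hi * (b - a).
Proof.
move=> ab fdf dfb.
have D x : x \in `]a, b[%R -> is_derive x (1 : R) f (df x).
  by rewrite in_itv /= => /andP[ax xb]; apply: fdf; rewrite !ltW.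
have D' : {in `[a, b]%R, forall x, derivable f x (1 : R)}.
  by move=> x; rewrite in_itv /= => /fdf[].
have [c cab ->] := MVT_segment ab D (@derivable_within_continuous _ _ _ _ D').
have /dfb/andP[l h] : a <= c <= b by move: cab; rewrite in_itv.
by rewrite !ler_wpM2r ?subr_ge0.
Qed.

Lemma intermediate_value f df a b v : a <= b ->
  (forall x, a <= x <= b -> is_derive x (1 : R) f (df x)) ->
  f a <= v <= f b -> exists2 c, a <= c <= b & f c = v.
Proof.
move=> ab fdf /andP[av vb].
have D : {in `[a, b]%R, forall x, derivable f x (1 : R)}.
  by move=> x; rewrite in_itv /= => /fdf[].
have fab := le_trans av vb.
have vfab : Num.min (f a) (f b) <= v <= Num.max (f a) (f b).
  by rewrite (min_idPl fab) (max_idPr fab) av vb.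
have [c] := IVT ab (@derivable_within_continuous _ _ _ _ D) vfab.
by rewrite in_itv; exists c.
Qed.

End Calculus.

Section Integration.
Variables (R : realType) (T : finType) (e : rel T).
Hypothesis simp : simple_graph e.
Hypothesis trans : transitive_graph e.
Variable Omega : nat.
Hypothesis reg : forall x, degree e x = Omega.
Implicit Types (p q : R) (o x u v : T).

Lemma tau_mono p q x y : 0 <= p -> p <= q -> q <= 1 -> tau e p x y <= tau e q x y.
Proof.
move=> p0 pq q1; rewrite !tauE; apply: bmean_mono => // w w'.
exact: mem_cluster_mono.
Qed.

Lemma chi_mono p q o : 0 <= p -> p <= q -> q <= 1 -> chi e p o <= chi e q o.
Proof. by move=> *; rewrite !chi_tau; apply: ler_sum => y _; apply: tau_mono. Qed.

Lemma triangle_mono p q a0 : 0 <= p -> p <= q -> q <= 1 ->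
  triangle_condition e q a0 -> triangle_condition e p a0.
Proof.
move=> p0 pq q1 tri x y; apply: le_trans (tri x y).
have t0 u v : 0 <= tau e p u v by apply: tau_ge0; rewrite p0 (le_trans pq).
apply: ler_sum => u _; apply: ler_sum => v _.
by rewrite !ler_pM ?mulr_ge0 ?tau_mono.
Qed.

Lemma inv_chi_derive p o : 0 <= p <= 1 ->
  is_derive p (1 : R) (fun q => - (chi e q o)^-1) (dchi e p o / chi e p o ^+ 2).
Proof.
move=> p01; have c1 := chi_ge1 e p01 o.
have c0 : chi e p o != 0 by rewrite gt_eqF // (lt_le_trans ltr01).
have := is_deriveN (is_deriveV c0 (chi_derive e p o)).
by congr is_derive; rewrite scaleNr opprK /GRing.scale /= mulrC.
Qed.

Lemma inv_chi_sub_le p q o : 0 <= p -> p <= q -> q <= 1 ->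
  (chi e p o)^-1 - (chi e q o)^-1 <= Omega%:R * (q - p).
Proof.
move=> p0 pq q1.
have in01 r : p <= r <= q -> 0 <= r <= 1.
  by case/andP=> pr rq; rewrite (le_trans p0 pr) (le_trans rq q1).
have := @increment_bounds R (fun q => - (chi e q o)^-1)
  (fun p => dchi e p o / chi e p o ^+ 2) p q 0 Omega%:R pq
  (fun r pr => inv_chi_derive o (in01 r pr)).
rewrite opprK (addrC (- (chi e q o)^-1)) => /(_ _)/andP[|_ //] r /in01 r01.
have c1 := chi_ge1 e r01 o; have c2 : 0 < chi e r o ^+ 2.
  by rewrite exprn_gt0 // (lt_le_trans ltr01).
rewrite ler_pdivrMr // (dchi_le simp trans reg) // andbT divr_ge0 ?(ltW c2) //.
apply: sumr_ge0 => b _; apply: bmean_ge0 => // w; rewrite subr_ge0 ler_nat.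
by apply: card_cluster_mono; apply: subset_trans (subsetDl _ _) (subsetUr _ _).
Qed.

Lemma inv_chi_sub_ge p q a0 o : 0 <= p -> p <= q -> q <= 1 ->
  triangle_condition e q a0 ->
  (1 - a0) * Omega%:R * (q - p) <= (chi e p o)^-1 - (chi e q o)^-1.
Proof.
move=> p0 pq q1 tri.
have in01 r : p <= r <= q -> 0 <= r <= 1.
  by case/andP=> pr rq; rewrite (le_trans p0 pr) (le_trans rq q1).
have := @increment_bounds R (fun q => - (chi e q o)^-1)
  (fun p => dchi e p o / chi e p o ^+ 2) p q ((1 - a0) * Omega%:R) Omega%:R pq
  (fun r pr => inv_chi_derive o (in01 r pr)).
rewrite opprK (addrC (- (chi e q o)^-1)) => /(_ _)/andP[|//] r prq; have r01 := in01 r prq.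
have c1 := chi_ge1 e r01 o; have c2 : 0 < chi e r o ^+ 2.
  by rewrite exprn_gt0 // (lt_le_trans ltr01).
rewrite ler_pdivrMr // (dchi_le simp trans reg) // andbT ler_pdivlMr //.
apply: (dchi_ge simp trans reg) => //; case/andP: prq => pr rq.
by apply: (@triangle_mono r q) => //; apply: le_trans pr.
Qed.

End Integration.

(** * Exponential moments *)

Section ExponentialMoment.
Variables (R : realType) (T : finType) (e : rel T).
Variable p : R.
Hypothesis p01 : 0 <= p <= 1.
Hypothesis simp : simple_graph e.
Hypothesis trans : transitive_graph e.
Variable o : T.

Local Notation E := (bond_mean e p).

Definition exp_moment (t : R) : R :=
  E (fun w => #|cluster w o|%:R * expR (t * #|cluster w o|%:R)).

Lemma card_cluster_ge1 (w : {set {set T}}) : 1 <= #|cluster w o|%:R :> R.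
Proof. by rewrite ler1n card_gt0; apply/set0Pn; exists o; apply: mem_cluster. Qed.

Lemma exp_moment_gt0 t : 0 <= t -> 0 < exp_moment t.
Proof.
move=> t0; apply: (@lt_le_trans _ _ 1) => //.
rewrite -[leLHS](bmean_cst p (enum (bonds e)) 1); apply: bmean_le => // w.
have c1 := card_cluster_ge1 w.
rewrite -[leLHS]mulr1 ler_pM // -expR0 ler_expR mulr_ge0 //.
Qed.

Lemma exp_moment_derive t : is_derive t (1 : R) exp_moment
  (E (fun w => #|cluster w o|%:R ^+ 2 * expR (t * #|cluster w o|%:R))).
Proof.
apply: (bmean_param_derive p (enum (bonds e))
  (f := fun u w => #|cluster w o|%:R * expR (u * #|cluster w o|%:R))
  (f' := fun u w => #|cluster w o|%:R ^+ 2 * expR (u * #|cluster w o|%:R))) => w.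
set c : R := #|cluster w o|%:R.
have D1 : is_derive t (1 : R) (fun u => u * c) c.
  have := is_deriveM (is_derive_id t (1 : R)) (is_derive_cst c t (1 : R)).
  by congr is_derive; rewrite scaler0 add0r /GRing.scale /= mulr1.
have De := @is_derive1_comp R expR (fun u : R => u * c) t _ _ (is_derive_expR (t * c)) D1.
have D2 := is_deriveZ c De.
move: D2; congr is_derive; rewrite /GRing.scale /=; ring.
Qed.

Lemma exp_moment0 : exp_moment 0 = chi e p o.
Proof. by rewrite chiE; apply: eq_bmean => w; rewrite mul0r expR0 mulr1. Qed.

(** From [m' <= m^3]: the derivative of [- m^(-2)] is [2 m' m^(-3) <= 2]. *)
Lemma exp_moment_bound t : 0 <= t -> (chi e p o ^+ 2)^-1 - 2 * t <= (exp_moment t ^+ 2)^-1.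
Proof.
move=> t0.
pose m' s := E (fun w => #|cluster w o|%:R ^+ 2 * expR (s * #|cluster w o|%:R)).
have D s : 0 <= s <= t ->
    is_derive s (1 : R) (fun u => - (exp_moment u ^+ 2)^-1) (2 * m' s / exp_moment s ^+ 3).
  move=> /andP[s0 _]; have m0 := exp_moment_gt0 s0.
  have n0 : exp_moment s ^+ 2 != 0 by rewrite gt_eqF // exprn_gt0.
  have D2 : is_derive s (1 : R) (fun u => exp_moment u ^+ 2) (2 * exp_moment s * m' s).
    have Dm := exp_moment_derive s; have := is_deriveM Dm Dm.
    by congr is_derive; rewrite /GRing.scale /= -/(m' s); ring.
  have := is_deriveN (@is_deriveV _ (fun u => exp_moment u ^+ 2) _ _ _ n0 D2).
  congr is_derive; rewrite scaleNr opprK /GRing.scale /=.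
  by field; rewrite gt_eqF.
have := increment_bounds (lo := 0) (hi := 2) t0 D.
rewrite exp_moment0 opprK subr0 => /(_ _)/andP[|_ H]; last by lra.
move=> s /andP[s0 _]; have m0 := exp_moment_gt0 s0.
have m3 : 0 < exp_moment s ^+ 3 by rewrite exprn_gt0.
rewrite ler_pdivrMr // ler_pM2l // exp_moment_step // andbT.
rewrite divr_ge0 ?(ltW m3) // mulr_ge0 //; apply: bmean_ge0 => // w; rewrite mulr_ge0 ?expR_ge0 //.
Qed.

End ExponentialMoment.

(** * A lower bound on the second moment *)

Section FisherInformation.
Variables (R : realType) (T : finType) (e : rel T).
Hypothesis simp : simple_graph e.
Hypothesis trans : transitive_graph e.
Variable Omega : nat.
Hypothesis reg : forall x, degree e x = Omega.
Variable p : R.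
Hypothesis p01 : 0 <= p <= 1.
Variable o : T.
Implicit Types (b c : {set T}) (w : {set {set T}}).

Local Notation E := (bond_mean e p).
Local Notation touches b w := (b \in touching (cluster w o)).

Lemma untouched_flip b w : b \in bonds e -> ~~ touches b (w :\ b) ->
  cluster (b |: w) o = cluster (w :\ b) o.
Proof.
move=> /(bondsP simp)[u [v [_ _ ->]]]; rewrite inE negbK => dis.
have -> : [set u; v] |: w = [set u; v] |: (w :\ [set u; v]).
  by apply/setP => c; rewrite !inE; case: (c == _).
have notin x : x \in [set u; v] -> x \notin cluster (w :\ [set u; v]) o.
  by move=> xb; rewrite (disjointFr dis xb).
by rewrite cluster_addb !ifN ?setU0 ?notin // !inE eqxx ?orbT.
Qed.

Lemma touches_mono b w w' : w \subset w' -> touches b w -> touches b w'.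
Proof.
move=> ww'; rewrite !inE; apply: contra => dis.
by apply: disjointWr dis; apply: cluster_mono.
Qed.

Lemma touches_flip b w : b \in bonds e -> touches b (b |: w) = touches b (w :\ b).
Proof.
move=> bB; apply/idP/idP => [|]; last first.
  by apply: touches_mono; apply: subset_trans (subsetDl _ _) (subsetUr _ _).
by apply: contraTT => nt; rewrite untouched_flip.
Qed.

Lemma touches_on b w : b \in bonds e -> touches b (b |: w) = touches b w.
Proof.
move=> bB; have [bw|bw] := boolP (b \in w).
  by rewrite (_ : b |: w = w) //; apply/setUidPr; rewrite sub1set.
rewrite touches_flip // (_ : w :\ b = w) //.
by apply/setDidPl; rewrite disjoint_sym disjoints1.
Qed.

Lemma touches_off b w : b \in bonds e -> touches b (w :\ b) = touches b w.
Proof. by move=> bB; rewrite -touches_flip // touches_on. Qed.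

(** [score w / (p (1 - p))] is the derivative in [p] of the logarithm of the
    probability of the explored part of the configuration. *)
Definition score w : R := \sum_(b <- enum (bonds e)) (touches b w)%:R * ((b \in w)%:R - p).

(** A bond that does not touch the cluster whatever its state does not influence the
    cluster, so its term in Russo's formula vanishes. *)
Lemma dchi_score : p * (1 - p) * dchi e p o = E (fun w => #|cluster w o|%:R * score w).
Proof.
rewrite /dchi mulr_sumr.
have -> : E (fun w => #|cluster w o|%:R * score w) = \sum_(b <- enum (bonds e))
   E (fun w => #|cluster w o|%:R * (touches b w)%:R * ((b \in w)%:R - p)).
  rewrite -bmean_sum; apply: eq_bmean => w; rewrite mulr_sumr.
  by apply: eq_bigr => b _; rewrite mulrA.
rewrite big_seq [RHS]big_seq; apply: eq_bigr => b bB.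
rewrite bmean_score ?enum_uniq //; congr (_ * _); apply: eq_bmean => w.
rewrite mem_enum in bB; rewrite touches_flip //.
have [t|t] := boolP (touches b (w :\ b)); first by rewrite !mulr1.
by rewrite untouched_flip // !subrr.
Qed.

(** The score is a martingale along the exploration of the cluster. Concretely, if the
    state of [b] decides whether [c] touches the cluster, then [b] touches it
    even when [c] is vacant, so that the state of [c] does not decide whether [b]
    touches it; in each case one of the two centred factors is independent of the rest. *)
Lemma score_cov b c : b \in bonds e -> c \in bonds e -> b != c ->
  E (fun w => (touches b w)%:R * ((b \in w)%:R - p) *
              ((touches c w)%:R * ((c \in w)%:R - p))) = 0.
Proof.
move=> bB cB bc.
have -> : E (fun w => (touches b w)%:R * ((b \in w)%:R - p) *
              ((touches c w)%:R * ((c \in w)%:R - p))) =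
  E (fun w => (touches b w)%:R * (touches c w)%:R * ((c \in w)%:R - p) * ((b \in w)%:R - p)).
  by apply: eq_bmean => w; ring.
rewrite bmean_score ?enum_uniq ?mem_enum //.
have -> : E (fun w => (touches b (b |: w))%:R * (touches c (b |: w))%:R * ((c \in b |: w)%:R - p) -
    (touches b (w :\ b))%:R * (touches c (w :\ b))%:R * ((c \in w :\ b)%:R - p)) =
  E (fun w => (touches b w)%:R *
    ((touches c (b |: w))%:R - (touches c (w :\ b))%:R) * ((c \in w)%:R - p)).
  apply: eq_bmean => w; rewrite (touches_on w bB) (touches_off w bB).
  by rewrite in_setU1 in_setD1 (eq_sym c b) (negbTE bc) /=; ring.
rewrite bmean_score ?enum_uniq ?mem_enum //.
rewrite -[RHS](mulr0 (p * (1 - p))); congr (_ * _); rewrite -[RHS](mulr0 (p * (1 - p))).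
congr (_ * _); rewrite -[RHS](bmean_cst p (enum (bonds e)) 0); apply: eq_bmean => w.
have comm1 : b |: (w :\ c) = (b |: w) :\ c.
  by apply/setP => x; rewrite !inE; case: (eqVneq x b) => [->|]; rewrite ?bc.
have comm2 : (c |: w) :\ b = c |: (w :\ b).
  by apply/setP => x; rewrite !inE; case: (eqVneq x c) => [->|]; rewrite 1?eq_sym ?bc.
have comm3 : (w :\ c) :\ b = (w :\ b) :\ c by apply/setP => x; rewrite !inE andbCA.
rewrite (setUCA [set b] [set c] w) comm2 (touches_on (b |: w) cB) (touches_on (w :\ b) cB).
rewrite comm1 comm3 (touches_off (b |: w) cB) (touches_off (w :\ b) cB).
rewrite -mulrBl.
have [tb|tb] := boolP (touches b (w :\ c)).
  have -> : touches b (c |: w).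
    by apply: touches_mono tb; apply: subset_trans (subsetDl _ _) (subsetUr _ _).
  by rewrite subrr mul0r.
suff -> : touches c (b |: w) = touches c (w :\ b) by rewrite subrr mulr0.
rewrite -(touches_off (b |: w) cB) -(touches_off (w :\ b) cB) -comm1 -comm3.
by rewrite untouched_flip // touches_off.
Qed.

Lemma score_var b : b \in bonds e ->
  E (fun w => (touches b w)%:R * ((b \in w)%:R - p) *
              ((touches b w)%:R * ((b \in w)%:R - p))) =
  p * (1 - p) * E (fun w => (touches b w)%:R).
Proof.
move=> bB.
have -> : E (fun w => (touches b w)%:R * ((b \in w)%:R - p) *
              ((touches b w)%:R * ((b \in w)%:R - p))) =
  E (fun w => (touches b w)%:R * ((b \in w)%:R - p) * ((b \in w)%:R - p)).
  by apply: eq_bmean => w; case: (touches b w); rewrite /= ?mul1r ?mul0r.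
rewrite bmean_score ?enum_uniq ?mem_enum //; congr (_ * _); apply: eq_bmean => w.
by rewrite (touches_on w bB) (touches_off w bB) setU11 setD11 /=; ring.
Qed.

Lemma card_touching w :
  (\sum_(b <- enum (bonds e)) touches b w <= Omega * #|cluster w o|)%N.
Proof.
rewrite big_enum /= -big_mkcondr /= sum1dep_card.
pose P := [set u : T * T | (u.1 \in cluster w o) && e u.1 u.2].
have -> : (Omega * #|cluster w o| = #|P|)%N.
  transitivity (\sum_(x in cluster w o) \sum_(y | e x y) 1)%N.
    rewrite mulnC -sum_nat_const; apply: eq_bigr => x _.
    by rewrite -(reg x) /degree sum1dep_card.
  by rewrite pair_big_dep /= sum1dep_card.
apply: leq_trans (leq_imset_card (fun u : T * T => [set u.1; u.2]) P).
apply: subset_leq_card; apply/subsetP => b; rewrite !inE => /andP[].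
case/(bondsP simp)=> u [v [euv _ ->]]; rewrite -setI_eq0 => /set0Pn[x].
rewrite !inE => /andP[/orP[] /eqP -> xo]; apply/imsetP.
  by exists (u, v); rewrite // !inE xo.
by exists (v, u); rewrite /= ?[[set v; u]]setUC // !inE xo /=; case: simp => ->.
Qed.

Lemma score_second_moment : E (fun w => score w ^+ 2) <= p * (1 - p) * (Omega%:R * chi e p o).
Proof.
have pp : 0 <= p * (1 - p) by case/andP: p01 => *; rewrite mulr_ge0 // subr_ge0.
have -> : E (fun w => score w ^+ 2) = p * (1 - p) *
     E (fun w => \sum_(b <- enum (bonds e)) (touches b w)%:R).
  rewrite bmean_sum mulr_sumr.
  have -> : E (fun w => score w ^+ 2) = \sum_(b <- enum (bonds e)) \sum_(c <- enum (bonds e))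
    E (fun w => (touches b w)%:R * ((b \in w)%:R - p) *
              ((touches c w)%:R * ((c \in w)%:R - p))).
    under [RHS]eq_bigr => b _ do rewrite -bmean_sum.
    by rewrite -bmean_sum; apply: eq_bmean => w; rewrite expr2 /score big_distrlr.
  rewrite big_seq [RHS]big_seq; apply: eq_bigr => b bE.
  have bB : b \in bonds e by rewrite -mem_enum.
  rewrite (big_rem b) //= (score_var bB) big_seq big1 ?addr0 // => c.
  rewrite mem_rem_uniq ?enum_uniq // inE => /andP[cb cE].
  have cB : c \in bonds e by rewrite -mem_enum.
  by apply: score_cov; rewrite // eq_sym.
rewrite ler_wpM2l // chiE -bmeanZ; apply: bmean_le => // w.
by rewrite -natr_sum -natrM ler_nat card_touching.
Qed.

(** Durrett and Nguyen's inequality: Cauchy - Schwarz between the cluster size and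
    the score, in the form [2kxy <= x^2 + k^2 y^2] with the optimal [k]. *)
Lemma moment2_ge a0 : a0 <= 1 -> triangle_condition e p a0 ->
  (1 - a0) ^+ 2 * (Omega%:R * p * (1 - p)) * chi e p o ^+ 3 <=
  E (fun w => #|cluster w o|%:R ^+ 2).
Proof.
move=> a01 tri.
have pp : 0 <= p * (1 - p) by case/andP: p01 => *; rewrite mulr_ge0 // subr_ge0.
have c1 := chi_ge1 e p01 o.
set k := (1 - a0) * chi e p o.
have k0 : 0 <= k by rewrite mulr_ge0 ?subr_ge0 // (le_trans ler01).
have Z := dchi_ge simp trans reg o p01 tri.
have Y := score_second_moment.
have XYZ : 2 * k * E (fun w => #|cluster w o|%:R * score w) <=
  E (fun w => #|cluster w o|%:R ^+ 2) + k ^+ 2 * E (fun w => score w ^+ 2).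
  rewrite -!bmeanZ -bmeanD; apply: bmean_le => // w.
  by have := sqr_ge0 (#|cluster w o|%:R - k * score w); lra.
move: XYZ; rewrite -dchi_score.
have Z' : 2 * k * (p * (1 - p) * ((1 - a0) * Omega%:R * chi e p o ^+ 2)) <=
    2 * k * (p * (1 - p) * dchi e p o).
  by apply: ler_wpM2l; [apply: mulr_ge0|apply: ler_wpM2l].
have Y' : k ^+ 2 * E (fun w => score w ^+ 2) <= k ^+ 2 * (p * (1 - p) * (Omega%:R * chi e p o)).
  by rewrite ler_wpM2l // exprn_ge0.
move=> XYZ; rewrite /k in Z' Y' XYZ *; lra.
Qed.

End FisherInformation.

(** * Tails of the cluster size and the largest cluster *)

Section Tails.
Variables (R : realType) (T : finType) (e : rel T).
Hypothesis simp : simple_graph e.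
Hypothesis trans : transitive_graph e.
Variable p : R.
Hypothesis p01 : 0 <= p <= 1.
Variable o : T.
Implicit Types (w : {set {set T}}) (k t : R).

Local Notation E := (bond_mean e p).
Local Notation chi := (chi e p o).
Local Notation V := (#|T|%:R : R).
Local Notation M w := ((max_cluster w)%:R : R).

Definition tail k : R := E (fun w => ((k <= #|cluster w o|%:R)%R)%:R).

Let chi1 : 1 <= chi. Proof. exact: chi_ge1. Qed.
Let chi0 : 0 < chi. Proof. exact: lt_le_trans ltr01 chi1. Qed.

(** With [x0 = 4 chi^2], the cluster size [x] satisfies
    [x^2 <= x chi^2 / 16 + 1(x >= chi^2/16) x0^2/3 + 2 x^3/(3 x0)]: for large [x] this
    is the tangent inequality [(x - x0)^2 (2x + x0) >= 0]. Taking means, the third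
    moment cannot account for the whole second moment, and the remainder bounds the
    tail from below. *)
Lemma tail_ge_of_moment2 : 18 / 25 * chi ^+ 3 <= E (fun w => #|cluster w o|%:R ^+ 2) ->
  (90 * chi)^-1 <= tail (chi ^+ 2 / 16).
Proof.
move=> m2; have m3 := moment3_le p01 simp trans o.
have : E (fun w => 12 * chi ^+ 2 * #|cluster w o|%:R ^+ 2) <=
    12 * chi ^+ 2 * (chi ^+ 2 / 16) * E (fun w => #|cluster w o|%:R) +
    64 * chi ^+ 6 * tail (chi ^+ 2 / 16) + 2 * E (fun w => #|cluster w o|%:R ^+ 3).
  rewrite /tail -!bmeanZ -!bmeanD; apply: bmean_le => // w.
  set x : R := #|cluster w o|%:R; have x0 : 0 <= x by [].
  set y := chi ^+ 2; have -> : chi ^+ 6 = y ^+ 3 by rewrite -exprM.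
  have y0 : 0 <= y by rewrite exprn_ge0 // ltW.
  case: (leP (y / 16) x) => [_|xs].
    rewrite /= mulr1; have : 0 <= (x - 4 * y) ^+ 2 * (2 * x + 4 * y).
      by rewrite mulr_ge0 ?sqr_ge0 // addr_ge0 // mulr_ge0.
    have : 0 <= y * y * x by apply: mulr_ge0; [apply: mulr_ge0|].
    by move=> ? ?; lra.
  rewrite /= mulr0 addr0; have : 0 <= x ^+ 3 by rewrite exprn_ge0.
  have : 0 <= 12 * y * x * (y / 16 - x).
    by apply: mulr_ge0; [apply: mulr_ge0; [apply: mulr_ge0|]|rewrite subr_ge0 ltW].
  by lra.
rewrite bmeanZ -chiE => H.
have chiX n : 0 < chi ^+ n by rewrite exprn_gt0.
rewrite -(ler_pM2l (chiX 6%N)) -(ler_pM2l (ltr0n R 64)).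
have -> : 64 * (chi ^+ 6 * (90 * chi)^-1) = 64 / 90 * chi ^+ 5.
  by field; rewrite gt_eqF.
have : 12 * chi ^+ 2 * (18 / 25 * chi ^+ 3) <= 12 * chi ^+ 2 * E (fun w => #|cluster w o|%:R ^+ 2).
  by apply: ler_wpM2l => //; rewrite mulr_ge0 // ltW.
have := chiX 5%N.
lra.
Qed.

Lemma max_clusterP w : exists x, max_cluster w = #|cluster w x|.
Proof.
have T0 : (0 < #|T|)%N by apply/card_gt0P; exists o.
by rewrite /max_cluster; have [x ->] := @bigop.eq_bigmax _ (fun x => #|cluster w x|) T0; exists x.
Qed.

Lemma cluster_le_max w x : (#|cluster w x| <= max_cluster w)%N.
Proof. exact: (leq_bigmax x). Qed.

(** The second moment method for the number [N] of vertices in clusters of size at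
    least [k]: two such vertices are in the same cluster, which contributes at most
    [V chi] to [E(N^2)], or in disjoint ones, which contribute at most [(E N)^2].
    Then [2 mu N - N^2 <= mu^2 1(N > 0)] is used with the optimal [mu]. *)
Lemma max_tail_ge k rho : 0 < rho -> rho <= tail k ->
  (1 + chi / (V * rho ^+ 2))^-1 <= E (fun w => ((k <= M w)%R)%:R).
Proof.
move=> rho0 rho_le; have V0 : 0 < V := natT_gt0 R o.
pose h n : R := ((k <= n%:R)%R)%:R.
have hmono : {homo h : m n / (m <= n)%N >-> m <= n}.
  by move=> m n mn; apply: nat_of_bool_le => /le_trans; apply; rewrite ler_nat.
have h0 n : 0 <= h n by [].
pose N w := \sum_x h #|cluster w x|.
have tailE x : E (fun w => h #|cluster w x|) = tail k by apply: mean_card_cluster.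
have EN : E N = V * tail k.
  by rewrite bmean_sum (eq_bigr _ (fun x _ => tailE x)) sumr_const mulr_natl.
have EN2 : E (fun w => N w ^+ 2) <= V * chi + V ^+ 2 * tail k ^+ 2.
  apply: (@le_trans _ _ (\sum_x \sum_y (E (fun w => (y \in cluster w x)%:R) +
     E (fun w => (y \notin cluster w x)%:R * (h #|cluster w x| * h #|cluster w y|))))).
    under eq_bigr => x _ do under eq_bigr => y _ do rewrite -bmeanD.
    under eq_bigr => x _ do rewrite -bmean_sum.
    rewrite -bmean_sum; apply: bmean_le => // w; rewrite expr2 big_distrlr.
    apply: ler_sum => x _; apply: ler_sum => y _.
    case: (y \in _); rewrite /= ?mul0r ?addr0 ?add0r ?mul1r //.
    rewrite /h; case: (k <= _); case: (k <= _); rewrite ?mulr0 ?mul0r ?mulr1 //.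
  have -> : V * chi + V ^+ 2 * tail k ^+ 2 =
    \sum_(x : T) \sum_(y : T) (tau e p x y + tail k * tail k).
    under eq_bigr => x _ do rewrite big_split /= sumr_const -chi_tau (chi_trans simp trans p x o).
    rewrite big_split /= !sumr_const -(mulr_natl chi) -(mulr_natl (tail k * tail k) #|T|).
    by rewrite -(mulr_natl (V * (tail k * tail k))); ring.
  apply: ler_sum => x _; apply: ler_sum => y _; rewrite -tauE lerD2l.
  by rewrite -{1}(tailE x) -(tailE y); apply: (@pair_cluster_le R T e p p01 id h h x y).
set P := tail k in rho_le EN EN2 *.
have P0 : 0 < P := lt_le_trans rho0 rho_le.
(* the upper bound on the second moment of [N] divided by its mean *)
pose mu := chi / P + V * P.
have mu0 : 0 < mu by rewrite addr_gt0 ?divr_gt0 ?mulr_gt0.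
have : E (fun w => 2 * mu * N w - N w ^+ 2) <= mu ^+ 2 * E (fun w => ((k <= M w)%R)%:R).
  rewrite -bmeanZ; apply: bmean_le => // w; case: (leP k (M w)) => [_|Mk].
    by rewrite /= mulr1; have := sqr_ge0 (mu - N w); lra.
  rewrite (_ : N w = 0) ?expr0n /= ?mulr0 ?subrr //.
  apply: big1 => x _; rewrite /h leNgt (le_lt_trans _ Mk) //.
  by rewrite ler_nat cluster_le_max.
rewrite bmeanB bmeanZ EN => H.
have {}H : V * P * mu <= mu ^+ 2 * E (fun w => ((k <= M w)%R)%:R).
  apply: le_trans H.
  have : V * chi + V ^+ 2 * P ^+ 2 = V * P * mu by rewrite /mu; field; rewrite gt_eqF.
  by lra.
have {}H : V * P / mu <= E (fun w => ((k <= M w)%R)%:R).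
  rewrite ler_pdivrMr // -(ler_pM2r mu0); move: H; lra.
apply: le_trans H.
have -> : V * P / mu = (1 + chi / (V * P ^+ 2))^-1.
  rewrite /mu; field; rewrite ?gt_eqF //=.
  by rewrite addr_gt0 // !mulr_gt0.
have pos r : 0 < r -> 0 < 1 + chi / (V * r ^+ 2).
  by move=> r0; rewrite addr_gt0 // divr_gt0 // mulr_gt0 // exprn_gt0.
rewrite lef_pV2 ?posrE ?pos // lerD2l ler_pM2l // lef_pV2 ?posrE ?mulr_gt0 ?exprn_gt0 //.
by rewrite ler_pM2l // lerXn2r // ?nnegrE ltW.
Qed.

(** The vertices of the largest cluster all contribute, hence one factor of the
    square. *)
Lemma exp_max_le t : 0 <= t ->
  E (fun w => M w ^+ 2 * expR (t * M w)) <= V * exp_moment e p o t.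
Proof.
move=> t0.
have -> : V * exp_moment e p o t =
  \sum_x E (fun w => #|cluster w x|%:R * expR (t * #|cluster w x|%:R)).
  rewrite (eq_bigr (fun=> exp_moment e p o t)) ?sumr_const ?mulr_natl // => x _.
  by apply: (mean_card_cluster simp trans p (fun n => n%:R * expR (t * n%:R))).
rewrite -bmean_sum; apply: bmean_le => // w; have [x ->] := max_clusterP w.
have -> : #|cluster w x|%:R ^+ 2 * expR (t * #|cluster w x|%:R) =
  \sum_(y in cluster w x) #|cluster w y|%:R * expR (t * #|cluster w y|%:R) :> R.
  rewrite (eq_bigr (fun=> #|cluster w x|%:R * expR (t * #|cluster w x|%:R))).
    by rewrite sumr_const -[RHS]mulr_natl mulrA expr2.
  by move=> y /cluster_eq ->.
rewrite big_mkcond; by apply: ler_sum => y _; case: ifP => // _; rewrite mulr_ge0 ?expR_ge0.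
Qed.

Section Chernoff.
Variable k : R.
Hypothesis k_gt : chi ^+ 2 < k.

Let chi2 : 0 < chi ^+ 2. Proof. by rewrite exprn_gt0. Qed.
Let k0 : 0 < k. Proof. exact: lt_trans k_gt. Qed.
Let t := (2 * chi ^+ 2)^-1 - (2 * k)^-1.
Let t0 : 0 < t.
Proof. by rewrite subr_gt0 ltf_pV2 ?posrE ?mulr_gt0 // ltr_pM2l. Qed.

(** The value [V m(t) exp(-tk) / k^2] of the exponential Markov bound, with [m(t)]
    replaced by its upper bound [sqrt k]. *)
Definition chernoff : R := V * Num.sqrt k / k ^+ 2 * expR (2^-1 - k / (2 * chi ^+ 2)).

Lemma exp_moment_le_sqrt : exp_moment e p o t <= Num.sqrt k.
Proof.
have m0 := exp_moment_gt0 e p01 o (ltW t0).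
have := exp_moment_bound p01 simp trans o (ltW t0).
rewrite (_ : _ - _ = k^-1); last by rewrite /t; field; rewrite !gt_eqF.
rewrite lef_pV2 ?posrE ?exprn_gt0 // => H.
by rewrite -(ger0_norm (ltW m0)) -sqrtr_sqr ler_wsqrtr.
Qed.

Lemma exp_max_chernoff : E (fun w => M w ^+ 2 / k ^+ 2 * expR (t * (M w - k))) <= chernoff.
Proof.
have -> : E (fun w => M w ^+ 2 / k ^+ 2 * expR (t * (M w - k))) =
  E (fun w => M w ^+ 2 * expR (t * M w)) * (expR (- (t * k)) / k ^+ 2).
  by rewrite -bmeanZr; apply: eq_bmean => w; rewrite mulrBr expRD; ring.
have -> : chernoff = V * Num.sqrt k * (expR (- (t * k)) / k ^+ 2).
  rewrite /chernoff (_ : _ - _ = - (t * k)) ?[in RHS]mulrA 1?mulrAC //.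
  by rewrite /t; field; rewrite !gt_eqF.
apply: ler_wpM2r; first by rewrite divr_ge0 ?expR_ge0 // exprn_ge0 // ltW.
apply: le_trans (exp_max_le (ltW t0)) _.
by rewrite ler_wpM2l // exp_moment_le_sqrt.
Qed.

Let weight_ge0 w : 0 <= M w ^+ 2 / k ^+ 2 * expR (t * (M w - k)).
Proof.
by apply: mulr_ge0; [apply: divr_ge0; apply: exprn_ge0 => //; exact: ltW|exact: expR_ge0].
Qed.

Lemma max_tail_le : E (fun w => ((k < M w)%R)%:R) <= chernoff.
Proof.
apply: le_trans exp_max_chernoff; apply: bmean_le => // w.
case: (ltP k (M w)) => [kM|_]; last by rewrite weight_ge0.
rewrite -[leLHS]mulr1; apply: ler_pM => //.
  by rewrite ler_pdivlMr ?exprn_gt0 // mul1r lerXn2r ?nnegrE ?(ltW k0) ?(ltW kM).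
rewrite -[leLHS](expR0 R) ler_expR; apply: mulr_ge0; first exact: ltW.
by rewrite subr_ge0 ltW.
Qed.

Lemma max_mean_le : E (fun w => M w) <= k + chernoff * (2 * chi ^+ 2 * k / (k - chi ^+ 2)).
Proof.
have -> : 2 * chi ^+ 2 * k / (k - chi ^+ 2) = t^-1.
  by rewrite /t; field; rewrite mulN1r subr_eq0 !gt_eqF.
apply: (@le_trans _ _ (k +
    E (fun w => M w ^+ 2 / k ^+ 2 * expR (t * (M w - k))) * t^-1)); last first.
  by rewrite lerD2l ler_wpM2r ?invr_ge0 ?(ltW t0) // exp_max_chernoff.
rewrite -[X in X + _](bmean_cst p (enum (bonds e))) -bmeanZr -bmeanD; apply: bmean_le => // w.
have ex0 := expR_ge0 (t * (M w - k)).
case: (leP (M w) k) => [Mk|kM].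
  rewrite -[leLHS]addr0; apply: lerD => //.
  by apply: mulr_ge0 => //; rewrite invr_ge0 ltW.
rewrite -lerBlDl ler_pdivlMr // mulrC.
apply: (@le_trans _ _ (expR (t * (M w - k)))).
  by apply: le_trans (expR_ge1Dx _); rewrite lerDr.
rewrite -[leLHS]mul1r ler_wpM2r // ler_pdivlMr ?exprn_gt0 // mul1r.
by rewrite lerXn2r ?nnegrE ?(ltW k0) ?(ltW kM).
Qed.

End Chernoff.

End Tails.

(** * The subcritical phase *)

Section Subcritical.
Variables (R : realType) (T : finType) (e : rel T).
Hypothesis simp : simple_graph e.
Hypothesis trans : transitive_graph e.
Hypothesis conn : connected_graph e.
Variable Omega : nat.
Hypothesis reg : forall x, degree e x = Omega.
Variable o : T.
Implicit Types (p q k : R).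

Lemma expect_bond p b : b \in bonds e -> bond_mean e p (fun w => (b \in w)%:R) = p.
Proof.
move=> bB; have := @bmean_score R _ p (enum (bonds e)) b (fun=> 1) (enum_uniq _).
rewrite mem_enum => /(_ bB); rewrite subrr bmean_cst mulr0.
rewrite (eq_bmean _ _ (fun w => mul1r _)) bmeanB bmean_cst => /eqP.
by rewrite subr_eq0 => /eqP.
Qed.

Lemma neighbour : (1 < #|T|)%N -> exists v, e o v.
Proof.
move=> T1; have [y yo] : exists y, y != o.
  apply/existsP; apply: contraTT T1 => /existsPn al.
  rewrite -leqNgt; apply/card_le1_eqP => x y _ _.
  by have := al x; have := al y; rewrite !negbK => /eqP -> /eqP ->.
have /connectP[[|v s] /=] := conn o y; first by move=> _ yE; rewrite yE eqxx in yo.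
by move=> /andP[ov _] _; exists v.
Qed.

Lemma degree_gt0 : (1 < #|T|)%N -> (0 < Omega)%N.
Proof.
move=> /neighbour[v ov]; rewrite -(reg o) /degree card_gt0.
by apply/set0Pn; exists v; rewrite inE.
Qed.

(** The two ends of a bond are connected with probability at least [p], and this
    connection is one of the terms of the triangle diagram. *)
Lemma le_triangle_bound p a0 : 0 <= p <= 1 -> (1 < #|T|)%N -> triangle_condition e p a0 -> p <= a0.
Proof.
move=> p01 /neighbour[v ov] tri.
have nov : o != v by apply: contraTneq ov => <-; case: simp => _ ->.
have := tri o v; rewrite (negbTE nov) add0r; apply: le_trans.
apply: (@le_trans _ _ (tau e p o v)).
  have bB : [set o; v] \in bonds e by apply/(bondsP simp); exists o, v.
  rewrite -[leLHS](expect_bond p bB) tauE; apply: bmean_le => // w; apply: nat_of_bool_le => ovw.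
  by apply: cluster_step ovw; apply: mem_cluster.
rewrite /nabla (bigD1 o) //= (bigD1 v) //= !tau_refl mul1r mulr1 -addrA lerDl.
have t0 x y : 0 <= tau e p x y by apply: tau_ge0.
by rewrite addr_ge0 //; do ![apply: sumr_ge0 => ? _]; rewrite ?mulr_ge0.
Qed.

(** The triangle diagram sums to [chi^3] over its free end. *)
Lemma chi_cube_le p a0 : triangle_condition e p a0 -> chi e p o ^+ 3 <= 1 + a0 * #|T|%:R.
Proof.
move=> tri.
have -> : chi e p o ^+ 3 = \sum_y nabla e p o y.
  rewrite /nabla exchange_big; under [RHS]eq_bigr => u _ do rewrite exchange_big /=.
  under [RHS]eq_bigr => u _ do under eq_bigr => v _ do
    rewrite -mulr_sumr -chi_tau (chi_trans simp trans p v o).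
  under [RHS]eq_bigr => u _ do rewrite -mulr_suml -mulr_sumr -chi_tau (chi_trans simp trans p u o).
  by rewrite -!mulr_suml -chi_tau exprSr expr2.
apply: le_trans (ler_sum _ (fun y _ => tri o y)) _.
rewrite big_split /= sumr_const mulr_natr lerD2r.
by rewrite (bigD1 o) //= eqxx big1 ?addr0 // => y; rewrite eq_sym => /negbTE ->.
Qed.

Lemma chi_at0 : chi e 0 o = 1 :> R.
Proof.
have at0 s f : bmean (0 : R) s f = f set0 :> R.
  by elim: s f => [|b s IHs] f //=; rewrite !IHs subr0 mul0r add0r mul1r.
by rewrite chiE at0 cluster_set0 cards1.
Qed.

Lemma tail_mono p q k : 0 <= p -> p <= q -> q <= 1 -> tail e p o k <= tail e q o k.
Proof.
move=> p0 pq q1; apply: bmean_mono => // w w' ww'; apply: nat_of_bool_le => /le_trans; apply.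
by rewrite ler_nat card_cluster_mono.
Qed.

Lemma max_cluster_gt0 (w : {set {set T}}) : (0 < max_cluster w)%N.
Proof.
apply: leq_trans (cluster_le_max w o).
by rewrite card_gt0; apply/set0Pn; exists o; apply: mem_cluster.
Qed.

Section Window.
Variables (p a0 : R).
Hypothesis p01 : 0 <= p <= 1.
Hypothesis T1 : (1 < #|T|)%N.
Hypothesis tri : triangle_condition e p a0.
Hypothesis a0_le : a0 <= 1 / 1000.

Local Notation chip := (chi e p o).
Local Notation V := (#|T|%:R : R).

(** Here [Omega q >= 1 - 1/chi(q) >= 3/4], and [1 - q] and [1 - a0] are close to
    [1]. The constant [18/25] is what the tail estimate asks for. *)
Lemma moment2_lower q : 0 <= q -> q <= p -> 4 <= chi e q o ->
  18 / 25 * chi e q o ^+ 3 <= bond_mean e q (fun w => #|cluster w o|%:R ^+ 2).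
Proof.
move=> q0 qp c4; have /andP[_ p1] := p01.
have q01 : 0 <= q <= 1 by rewrite q0 (le_trans qp).
have triq := triangle_mono q0 qp p1 tri.
have a01 : a0 <= 1 by apply: le_trans a0_le _; lra.
apply: le_trans (moment2_ge simp trans reg q01 o a01 triq).
have c0 : 0 < chi e q o by lra.
rewrite ler_pM2r ?exprn_gt0 //.
have qa := le_triangle_bound q01 T1 triq.
have Oq : 3 / 4 <= Omega%:R * q.
  have := inv_chi_sub_le simp trans reg o (lexx 0) q0 (le_trans qp p1).
  rewrite chi_at0 invr1 subr0 => H.
  have : (chi e q o)^-1 <= 1 / 4 by rewrite div1r lef_pV2 ?posrE.
  lra.
have [c [c_ge0 c_le cE]] : exists c : R,
    [/\ 0 <= c, c <= 1 - a0 & 18 / 25 <= c ^+ 2 * (3 / 4 * c)].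
  by exists (99 / 100); have a0_le' := a0_le; split; lra.
have Q : c <= 1 - q by lra.
have h34 : 0 <= 3 / 4 :> R by lra.
apply: (le_trans cE); apply: ler_pM.
- exact: exprn_ge0.
- exact: mulr_ge0.
- by apply: lerXn2r => //; rewrite nnegrE (le_trans c_ge0).
- exact: ler_pM.
Qed.

(** The tail is increasing in the parameter, so it suffices to bound it at the smaller
    parameter [q] where [k] is exactly [chi(q)^2 / 16]. It exists by continuity,
    since [chi] is [1] at parameter [0]. *)
Lemma tail_lower k : 1 <= k -> 16 * k <= chip ^+ 2 ->
  (360 * Num.sqrt k)^-1 <= tail e p o k.
Proof.
move=> k1 kchi; have /andP[p0 p1] := p01.
have k0 : 0 <= k by lra.
have s1 : 1 <= Num.sqrt k by rewrite -[leLHS](sqrtr1 R) ler_wsqrtr.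
have sk : Num.sqrt k ^+ 2 = k by rewrite sqr_sqrtr.
have chip1 := chi_ge1 e p01 o.
have s_le : 4 * Num.sqrt k <= chip.
  rewrite -(ler_pXn2r (_ : 0 < 2)%N) ?nnegrE //; [|lra..].
  by rewrite exprMn sk; lra.
have Dchi x : 0 <= x <= p -> is_derive x (1 : R) (fun q => chi e q o) (dchi e x o).
  by move=> _; apply: chi_derive.
have : chi e 0 o <= 4 * Num.sqrt k <= chi e p o by rewrite chi_at0 s_le andbT; lra.
move=> /(intermediate_value p0 Dchi)[q /andP[q0 qp] cq].
have q01 : 0 <= q <= 1 by rewrite q0 (le_trans qp).
apply: le_trans (tail_mono k q0 qp p1).
have -> : k = chi e q o ^+ 2 / 16 by rewrite cq exprMn sk; field.
have -> : (360 * Num.sqrt (chi e q o ^+ 2 / 16))^-1 = (90 * chi e q o)^-1.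
  rewrite [in LHS]cq exprMn sk (_ : _ / 16 = k) ?cq; last by field.
  by rewrite mulrA (_ : 90 * 4 = 360 :> R) //; lra.
apply: tail_ge_of_moment2 => //; apply: moment2_lower => //; rewrite cq; lra.
Qed.

(** With [rho = 1/(360 sqrt k)] and [k = chi^2/(3600 omega)], the quantity
    [chi/(V rho^2)] of the second moment method is [36 chi^3/(omega V)]. For
    [k <= 1] the event is certain. *)
Lemma max_tail_lower omega : 1 <= omega ->
  (1 + 36 * chip ^+ 3 / (omega * V))^-1 <=
  bond_mean e p (fun w => ((chip ^+ 2 / (3600 * omega) <= (max_cluster w)%:R)%R)%:R).
Proof.
move=> om1; have om0 : 0 < omega by lra.
have chip1 := chi_ge1 e p01 o; have chi0 : 0 < chip by lra.
have V0 : 0 < V := natT_gt0 R o.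
set k := chip ^+ 2 / (3600 * omega).
have [k1|k1] := leP k 1.
  have -> : bond_mean e p (fun w => ((k <= (max_cluster w)%:R)%R)%:R) = 1.
    rewrite -[RHS](bmean_cst p (enum (bonds e))); apply: eq_bmean => w.
    by rewrite (le_trans k1) // ler1n max_cluster_gt0.
  have x0 : 0 <= 36 * chip ^+ 3 / (omega * V).
    by rewrite divr_ge0 // mulr_ge0 ?exprn_ge0 ?(ltW chi0) ?(ltW om0).
  by rewrite invf_le1 ?lerDl // ltr_pwDl.
have k0 : 0 < k by lra.
have kE : 3600 * omega * k = chip ^+ 2 by rewrite /k; field; rewrite gt_eqF.
have k16 : 16 * k <= chip ^+ 2.
  have : 0 <= (omega - 1) * k by rewrite mulr_ge0 ?subr_ge0 // ltW.
  by rewrite -kE; lra.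
have s0 : 0 < Num.sqrt k by rewrite sqrtr_gt0.
have r0 : 0 < (360 * Num.sqrt k)^-1 by rewrite invr_gt0 mulr_gt0 ?ltr0n.
have := max_tail_ge simp trans p01 r0 (tail_lower (ltW k1) k16).
congr (_ <= _); congr (_^-1); congr (1 + _).
rewrite exprVn exprMn sqr_sqrtr ?ltW //.
have -> : chip ^+ 3 = chip * (3600 * omega * k) by rewrite kE -exprS.
by field; rewrite ?gt_eqF.
Qed.

Hypothesis V_large : 999 * chip ^+ 3 <= V.

Let chip1 : 1 <= chip. Proof. exact: chi_ge1. Qed.
Let chip0 : 0 < chip. Proof. exact: lt_le_trans ltr01 chip1. Qed.
Let chip3 : 0 < chip ^+ 3. Proof. by rewrite exprn_gt0. Qed.

Lemma mean_max_lower :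
  (10 ^+ 4)^-1 * chip ^+ 2 <= bond_mean e p (fun w => (max_cluster w)%:R).
Proof.
have V0 : 0 < V := natT_gt0 R o.
have := max_tail_lower (lexx 1); rewrite mulr1 mul1r.
set P := bond_mean e p _ => HP.
apply: (@le_trans _ _ (chip ^+ 2 / 3600 * P)); last first.
  rewrite /P -bmeanZ; apply: bmean_le => // w.
  by case: (leP (chip ^+ 2 / 3600) (max_cluster w)%:R) => H; rewrite /= ?mulr1 ?mulr0.
have : 36 / 100 <= P.
  apply: le_trans HP; rewrite -[leLHS]invrK lef_pV2 ?posrE; first last.
  - by rewrite addr_gt0 // divr_gt0 // mulr_gt0.
  - by rewrite invr_gt0; lra.
  have V_large' := V_large; have chip3' := chip3.
  by rewrite invf_div -lerBrDl ler_pdivrMr //; lra.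
move=> P_ge; have -> : (10 ^+ 4)^-1 * chip ^+ 2 = chip ^+ 2 / 3600 * (36 / 100) by field.
apply: ler_wpM2l; last exact: P_ge.
by apply: divr_ge0; [exact: sqr_ge0|exact: ler0n].
Qed.

Local Notation L := (ln (V / chip ^+ 3)).

Lemma expR1_le4 : expR 1 <= 4 :> R.
Proof.
have half : expR (1 / 2) <= 2 :> R.
  rewrite -[1 / 2]opprK expRN -[leRHS]invrK lef_pV2 ?posrE ?expR_gt0 ?invr_gt0 //.
  by apply: le_trans (expR_ge1Dx _); lra.
have -> : expR 1 = expR (1 / 2) * expR (1 / 2) :> R by rewrite -expRD; congr expR; lra.
have := expR_ge0 (1 / 2 : R); nra.
Qed.

Lemma log_ratio_ge4 : 4 <= L.
Proof.
have V0 : 0 < V := natT_gt0 R o.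
rewrite -ler_expR lnK ?posrE ?divr_gt0 //.
apply: (@le_trans _ _ 999); last by rewrite ler_pdivlMr.
have -> : expR 4 = expR 1 ^+ 4 :> R by rewrite -expRM_natl mulr1.
apply: (@le_trans _ _ (4 ^+ 4)); last by lra.
by apply: lerXn2r; rewrite ?nnegrE ?expR_ge0 ?expR1_le4.
Qed.

Lemma expR_oppL : expR (- L) = chip ^+ 3 / V.
Proof.
have V0 : 0 < V := natT_gt0 R o.
by rewrite expRN lnK ?posrE ?divr_gt0 // invf_div.
Qed.

(** The Chernoff bound at [k = 2 chi^2 L], where [exp(-L) = chi^3/V] cancels [V]. *)
Lemma max_tail_upper :
  bond_mean e p (fun w => ((2 * chip ^+ 2 * L < (max_cluster w)%:R)%R)%:R) <=
  Num.sqrt (expR 1) / (2 * L) `^ (3 / 2).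
Proof.
have V0 : 0 < V := natT_gt0 R o; have L4 := log_ratio_ge4.
have c2 : 0 < chip ^+ 2 by rewrite exprn_gt0.
set k := 2 * chip ^+ 2 * L.
have kchi : chip ^+ 2 < k by rewrite /k; nra.
apply: le_trans (max_tail_le simp trans p01 kchi) _.
have L0 : 0 <= 2 * L by lra.
have -> : (2 * L) `^ (3 / 2) = 2 * L * Num.sqrt (2 * L).
  rewrite (_ : 3 / 2 = 1 + 2^-1); last by field.
  rewrite powRD ?powRr1 ?powR12_sqrt //; apply/implyP => _; apply/eqP; lra.
have -> : Num.sqrt (expR 1) = expR (2^-1) :> R.
  by rewrite -powR12_sqrt ?expR_ge0 // -expRM mul1r.
rewrite /chernoff le_eqVlt; apply/orP; left; apply/eqP.
have -> : 2^-1 - k / (2 * chip ^+ 2) = 2^-1 + - L.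
  by rewrite /k; field; rewrite gt_eqF.
rewrite expRD expR_oppL.
have -> : Num.sqrt k = chip * Num.sqrt (2 * L).
  by rewrite /k mulrAC mulrC sqrtrM ?sqr_ge0 // sqrtr_sqr ger0_norm ?ltW.
set s := Num.sqrt (2 * L).
have s0 : 0 < s by rewrite sqrtr_gt0; lra.
have s2 : 2 * L = s ^+ 2 by rewrite sqr_sqrtr.
have -> : k = chip ^+ 2 * s ^+ 2 by rewrite -s2 /k; ring.
by rewrite s2; field; rewrite !gt_eqF.
Qed.

(** The Chernoff bound at [k = 2 chi^2 (L - 1)]: the excess over [k] has mean at
    most [2 chi^2] as soon as [L] is not too small. *)
Lemma mean_max_upper :
  bond_mean e p (fun w => (max_cluster w)%:R) <= 2 * chip ^+ 2 * L.
Proof.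
have V0 : 0 < V := natT_gt0 R o; have L4 := log_ratio_ge4.
have c2 : 0 < chip ^+ 2 by rewrite exprn_gt0.
pose q := 2 * (L - 1); have q6 : 6 <= q by rewrite /q; lra.
pose s := Num.sqrt q; have s2 : s ^+ 2 = q by rewrite sqr_sqrtr; lra.
have s0 : 0 < s by rewrite sqrtr_gt0; lra.
pose k := chip ^+ 2 * q.
have kchi : chip ^+ 2 < k by rewrite /k; nra.
apply: le_trans (max_mean_le simp trans p01 kchi) _.
have -> : 2 * chip ^+ 2 * L = k + 2 * chip ^+ 2 by rewrite /k /q; ring.
rewrite lerD2l /chernoff.
have -> : 2^-1 - k / (2 * chip ^+ 2) = 1 + (2^-1 + - L).
  by rewrite /k /q; field; rewrite gt_eqF.
have -> : Num.sqrt k = chip * s.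
  by rewrite /k sqrtrM ?sqr_ge0 // sqrtr_sqr ger0_norm ?ltW.
rewrite !expRD expR_oppL.
have e4 := expR1_le4.
have eh : expR (2^-1) <= 2 :> R.
  have e0 := expR_gt0 (2^-1 : R).
  have : expR (2^-1) * expR (2^-1) <= 4 :> R.
    by rewrite -expRD (_ : 2^-1 + 2^-1 = 1) //; field.
  nra.
have -> : V * (chip * s) / k ^+ 2 * (expR 1 * (expR 2^-1 * (chip ^+ 3 / V))) *
   (2 * chip ^+ 2 * k / (k - chip ^+ 2)) =
   2 * chip ^+ 2 * (expR 1 * expR 2^-1 / (s * (q - 1))).
  have n1 : s ^+ 2 - 1 != 0 by rewrite s2 gt_eqF //; lra.
  have n2 : (chip * s) ^+ 2 - chip ^+ 2 != 0.
    by rewrite exprMn -[X in _ - X]mulr1 -mulrBr mulf_neq0 // gt_eqF.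
  by rewrite /k -s2; field; rewrite n1 n2 !gt_eqF.
rewrite -[leRHS]mulr1 ler_wpM2l //; first by rewrite mulr_ge0 // ltW.
rewrite ler_pdivrMr ?mulr_gt0 //; last by lra.
rewrite mul1r; apply: (@le_trans _ _ (4 * 2)); first by apply: ler_pM; rewrite ?expR_ge0.
have : 2 <= s by rewrite -(ler_pXn2r (_ : 0 < 2)%N) ?nnegrE ?(ltW s0) // s2; lra.
nra.
Qed.

End Window.

End Subcritical.

Theorem theorem1p2 (R : realType) :
  exists b0 : R, 0 < b0 /\
  forall (lambda : R) (T : finType) (e : rel T) (o : T) (Omega : nat)
         (pc p eps : R),
    0 < lambda ->
    simple_graph e -> connected_graph e -> transitive_graph e ->
    (forall x : T, degree e x = Omega) ->
    1 < lambda_cbrtV T lambda < #|T|%:R ->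
    critical_threshold e o lambda pc ->
    0 <= p <= 1 -> 0 <= eps -> p = pc - Omega%:R^-1 * eps ->
    let V : R := #|T|%:R in
    let eps0 : R := (chi e pc o)^-1 in
    let chip : R := chi e p o in
    (forall a0 : R, a0 < 1 -> triangle_condition e pc a0 ->
       1 / (eps0 + eps) <= chip <= 1 / (eps0 + (1 - a0) * eps))
    /\
    (forall a0 : R, a0 <= b0 -> triangle_condition e pc a0 ->
       b0^-1 <= lambda_cbrtV T lambda ->
       [/\ (10 ^+ 4)^-1 * chip ^+ 2
             <= Expect e p (fun w => (max_cluster w)%:R)
             <= 2 * chip ^+ 2 * ln (V / chip ^+ 3),
           1 - Num.sqrt (expR 1) / (2 * ln (V / chip ^+ 3)) `^ (3 / 2)
             <= Prob e p (fun w =>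
                  (max_cluster w)%:R <= 2 * chip ^+ 2 * ln (V / chip ^+ 3))
         & forall omega : R, 1 <= omega ->
             (1 + 36 * chip ^+ 3 / (omega * V))^-1
               <= Prob e p (fun w =>
                    chip ^+ 2 / (3600 * omega) <= (max_cluster w)%:R)]).
Proof.
(* Any small enough constant works: the numerical margins are in the moment bound
   18/25 and in the size of the logarithm. *)
exists (1 / 1000); split; first by lra.
move=> lambda T e o Omega pc p eps lambda0 simp conn trans reg /andP[lV1 lVV].
move=> [/andP[pc0 pc1] chipc] /andP[p0 p1] eps0 pE V eps_0 chip.
have T1 : (1 < #|T|)%N by rewrite -(ltr_nat R); apply: lt_trans lV1 lVV.
have Om0 : 0 < Omega%:R :> R by rewrite ltr0n (degree_gt0 conn reg o).
have p01 : 0 <= p <= 1 by rewrite p0.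
have pc01 : 0 <= pc <= 1 by rewrite pc0.
have epsE : Omega%:R * (pc - p) = eps by rewrite pE; field; rewrite gt_eqF.
have ppc : p <= pc by rewrite pE lerBlDr lerDl mulr_ge0 // invr_ge0 ltW.
have c1 : 1 <= chip by apply: chi_ge1.
have c0 : 0 < chip by apply: lt_le_trans c1.
have cc1 := chi_ge1 e pc01 o.
have e0 : 0 < eps_0 by rewrite invr_gt0; apply: lt_le_trans cc1.
split=> [a0 a01 tri|a0 a0_le tri lVb].
  have up := inv_chi_sub_le simp trans reg o p0 ppc pc1.
  have lo := inv_chi_sub_ge simp trans reg o p0 ppc pc1 tri.
  rewrite -mulrA !epsE -/chip -/eps_0 in up lo.
  have pos : 0 < eps_0 + (1 - a0) * eps.
    by rewrite ltr_pwDl // mulr_ge0 // subr_ge0 ltW.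
  have pos' : 0 < eps_0 + eps by rewrite ltr_pwDl.
  have ci0 : 0 < chip^-1 by rewrite invr_gt0.
  apply/andP; split; rewrite div1r -[chip]invrK lef_pV2 ?posrE //; lra.
have trip := triangle_mono p0 ppc pc1 tri.
have V_large : 999 * chip ^+ 3 <= V.
  have cub := chi_cube_le simp trans o tri.
  have big : 1000 <= chi e pc o by rewrite chipc; move: lVb; rewrite div1r invrK.
  have cle : chip ^+ 3 <= chi e pc o ^+ 3.
    by apply: lerXn2r; rewrite ?nnegrE ?(ltW c0) ?(le_trans ler01 cc1) ?chi_mono.
  have one : 1000 <= chi e pc o ^+ 3.
    apply: (le_trans big); rewrite -[leLHS]expr1; apply: ler_eXn2l => //.
    by apply: lt_le_trans big; lra.
  have V0 : 0 <= V by [].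
  have : a0 * V <= 1 / 1000 * V by rewrite ler_wpM2r.
  rewrite -/V in cub; lra.
split.
- rewrite !ExpectE (mean_max_lower simp trans conn reg p01 T1 trip a0_le V_large) /=.
  exact: (mean_max_upper simp trans p01 V_large).
- rewrite ProbE lerBlDr addrC -lerBlDr.
  have := max_tail_upper simp trans p01 V_large.
  congr (_ <= _); rewrite -[X in _ = X - _](bmean_cst p (enum (bonds e)) 1) -bmeanB.
  by apply: eq_bmean => w; rewrite ltNge; case: (_ <= _); rewrite /= ?subrr ?subr0.
- move=> omega om1; rewrite ProbE.
  exact: (max_tail_lower simp trans conn reg o p01 T1 trip a0_le om1).
Qed.
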